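(* There is an absolute constant $c>0$ such that the following holds. Let $n\ge 1$, let $(\xi_i,\mathcal{F}_i)_{i=0,\dots,n}$ be a sequence of martingale differences, let $X_n=\sum_{i=1}^n\xi_i$, and assume that for some $\epsilon\in(0,\frac12]$ and some $\delta\in[0,\frac12]$ conditions (A1) and (A2) hold. Then $$\sup_{x\in\mathbb{R}}\big|\mathbb{P}(X_n\le x)-\Phi(x)\big|\le c\,\big(\epsilon|\log\epsilon|+\delta\big).$$
   Context: $(\xi_i,\mathcal{F}_i)_{i=0,\dots,n}$ is a sequence of square integrable real martingale differences on a probability space $(\Omega,\mathcal{F},\mathbb{P})$: $\xi_0=0$, $\{\emptyset,\Omega\}=\mathcal{F}_0\subseteq\dots\subseteq\mathcal{F}_n\subseteq\mathcal{F}$ are increasing $\sigma$-fields, each $\xi_i$ is $\mathcal{F}_i$-measurable and $\mathbb{E}(\xi_i|\mathcal{F}_{i-1})=0$ for $1\le i\le n$. The quadratic characteristic is $\langle X\rangle_n=\sum_{i=1}^n\mathbb{E}(\xi_i^2|\mathcal{F}_{i-1})$. (In)equalities between random variables hold $\mathbb{P}$-almost surely. $\Phi(x)=\frac{1}{\sqrt{2\pi}}\int_{-\infty}^x e^{-t^2/2}\,dt$ is the standard normal distribution function. Condition (A1), with parameter $\epsilon\in(0,\frac12]$: the moments exist and $|\mathbb{E}(\xi_i^k|\mathcal{F}_{i-1})|\le \frac12 k!\,\epsilon^{k-2}\,\mathbb{E}(\xi_i^2|\mathcal{F}_{i-1})$ for all $k\ge3$ and $1\le i\le n$. Condition (A2),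 with parameter $\delta\in[0,\frac12]$: $|\langle X\rangle_n-1|\le\delta^2$. *)

(* Defs.v *)
From HB Require Import structures.
From mathcomp Require Import all_boot all_order all_algebra.
From mathcomp Require Import all_classical all_reals all_analysis.
(* needed for the measurable structure of \bar R *)
From mathcomp Require Import measurable_realfun.

Set Implicit Arguments.
Unset Strict Implicit.
Unset Printing Implicit Defensive.

Import Order.TTheory GRing.Theory Num.Theory.
Import numFieldNormedType.Exports.

Local Open Scope classical_set_scope.
Local Open Scope ring_scope.

Section conditional_expectation.
Context (d : measure_display) (T : measurableType d) (R : realType).
Variable P : probability T R.
Implicit Types (G : set (set T)) (X Y Z : T -> R).

Definition sub_sigma_algebra_of G :=
  sigma_algebra setT G /\ G `<=` measurable.

(* [g_sigma_algebraType G] is [T] equipped with the sigma-algebra <<s G >>,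
   which is [G] itself when [G] is a sigma-algebra *)
Definition measurable_wrt G Y :=
  measurable_fun [set: g_sigma_algebraType G] (Y : g_sigma_algebraType G -> R).

(* Y is a version of E(X | G) *)
Definition is_cond_exp G X Y :=
  [/\ measurable_wrt G Y,
      P.-integrable setT (EFin \o Y) &
      forall A, G A ->
        (\int[P]_(w in A) (Y w)%:E = \int[P]_(w in A) (X w)%:E)%E].

(* A chosen version of E(X | G); by [cond_expP] below the default value is
   never used for an integrable X, and by [is_cond_exp_unique] the choice is
   irrelevant up to P-almost sure equality. *)
Definition cond_exp G X : T -> R := xget (cst 0) [set Y | is_cond_exp G X Y].

Section sub_sigma_algebra.
Variable G : set (set T).
Hypothesis subG : sub_sigma_algebra_of G.

Let GE : (measurable : set (set (g_sigma_algebraType G))) = G.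
Proof. exact: (measurable_g_measurableTypeE subG.1). Qed.

Let phi : T -> g_sigma_algebraType G := id.

Let mphi : measurable_fun [set: T] phi.
Proof. by move=> _ B mB; rewrite setTI; apply: subG.2; rewrite -GE. Qed.

HB.instance Definition _ := isMeasurableFun.Build _ _ _ _ phi mphi.

Let mu : probability (g_sigma_algebraType G) R := distribution P phi.

Lemma measurable_wrtW Y : measurable_wrt G Y -> measurable_fun [set: T] Y.
Proof. by move=> mY; exact: (measurableT_comp mY mphi). Qed.

Lemma cond_exp_exists X :
  P.-integrable setT (EFin \o X) -> exists Y, is_cond_exp G X Y.
Proof.
move=> iX.
pose q : {charge set T -> \bar R} := induced_charge iX.
pose nu_ : {charge set (g_sigma_algebraType G) -> \bar R} := pushforward q phi.
pose nu := nu_ mphi.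
have qP : q `<< P.
  apply/null_content_dominatesP => A mA PA0 /=.
  apply: null_set_integral => //.
  by apply: (measurable_funS measurableT) => //; apply: measurable_int iX.
have numu : nu `<< mu by exact: (dominates_pushforward _ qP).
pose f : g_sigma_algebraType G -> \bar R := Radon_Nikodym nu mu.
have fin x : f x \is a fin_num by exact: Radon_Nikodym_fin_num.
have fi : mu.-integrable setT f by exact: Radon_Nikodym_integrable.
have mf : measurable_fun [set: g_sigma_algebraType G] f.
  exact: measurable_int fi.
have fiP : P.-integrable setT (f \o phi).
  apply/integrableP; split; first exact: measurableT_comp.
  move/integrableP : fi => [_].
  by rewrite ge0_integral_pushforward//; exact: measurableT_comp.
have fE : EFin \o (fine \o f) = f by apply/funext => x /=; rewrite fineK.
exists (fine \o f); split.
- exact: (measurableT_comp (fine_measurable measurableT) mf).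
- by rewrite fE.
- move=> A GA.
  have mA : measurable (A : set (g_sigma_algebraType G)) by rewrite GE.
  transitivity (nu A); last by [].
  rewrite (Radon_Nikodym_integral numu mA) integral_pushforward//.
    by apply: eq_integral => w _ /=; rewrite fineK//; exact: fin.
  by apply: (integrableS measurableT) => //; exact: subG.2.
Qed.

Lemma cond_expP X :
  P.-integrable setT (EFin \o X) -> is_cond_exp G X (cond_exp G X).
Proof. by move=> iX; have := cond_exp_exists iX; exact: xgetPex. Qed.

Lemma is_cond_exp_unique X Y Z :
  is_cond_exp G X Y -> is_cond_exp G X Z -> {ae P, forall w, Y w = Z w}.
Proof.
move=> [mY iY YE] [mZ iZ ZE].
have mY' : measurable_fun [set: g_sigma_algebraType G] (EFin \o Y).
  exact/measurable_EFinP.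
have mZ' : measurable_fun [set: g_sigma_algebraType G] (EFin \o Z).
  exact/measurable_EFinP.
have : ae_eq mu setT (EFin \o Y : g_sigma_algebraType G -> \bar R) (EFin \o Z).
  apply: integral_ae_eq => //; first exact: integrable_pushforward.
  move=> A _ mA; have GA : G A by rewrite -GE.
  rewrite !integral_pushforward//; last 2 first.
    by apply: (integrableS measurableT) => //; exact: subG.2.
    by apply: (integrableS measurableT) => //; exact: subG.2.
  by rewrite [LHS]YE// ZE.
move=> [N [mN N0 YZN]]; exists N; split => //.
  by apply: subG.2; rewrite -GE.
by move=> w /= YZ; apply: YZN => /= /(_ I)[].
Qed.

End sub_sigma_algebra.
End conditional_expectation.

Section martingale_differences.
Context (d : measure_display) (T : measurableType d) (R : realType).
Variables (P : probability T R) (n : nat).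
Variables (F : nat -> set (set T)) (xi : nat -> T -> R).

(* Only the indices i <= n matter; xi and F are arbitrary beyond n. *)
Record martingale_difference : Prop := MartingaleDifference {
  md_sigma : forall i, (i <= n)%N -> sub_sigma_algebra_of (F i) ;
  md_trivial : F 0%N = [set set0; setT] ;
  md_filtration : forall i, (i < n)%N -> F i `<=` F i.+1 ;
  md_adapted : forall i, (i <= n)%N -> measurable_wrt (F i) (xi i) ;
  md_square : forall i, (i <= n)%N -> xi i \in Lfun P 2%:E ;
  md_init : {ae P, forall w, xi 0%N w = 0} ;
  md_centered : forall i, (1 <= i <= n)%N ->
    {ae P, forall w, cond_exp P (F i.-1) (xi i) w = 0}
}.

Definition cond_moment (k i : nat) : T -> R :=
  cond_exp P (F i.-1) (fun w => xi i w ^+ k).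

Definition quad_char (w : T) : R := \sum_(1 <= i < n.+1) cond_moment 2 i w.

Definition bernstein_condition (epsilon : R) : Prop :=
  forall k i, (3 <= k)%N -> (1 <= i <= n)%N ->
    P.-integrable setT (fun w => (xi i w ^+ k)%:E) /\
    {ae P, forall w, `|cond_moment k i w| <=
      2^-1 * (k`!)%:R * epsilon ^+ (k - 2) * cond_moment 2 i w}.

Definition quad_char_condition (delta : R) : Prop :=
  {ae P, forall w, `|quad_char w - 1| <= delta ^+ 2}.

End martingale_differences.

Definition std_normal_cdf (R : realType) (x : R) : \bar R :=
  normal_prob 0 1 `]-oo, x]%classic.

Lemma std_normal_cdfE (R : realType) (x : R) :
  std_normal_cdf x =
  (\int[lebesgue_measure]_(t in `]-oo, x]%classic)
     ((Num.sqrt (2 * pi))^-1 * expR (- (t ^+ 2 / 2)))%:E)%E.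
Proof.
apply: eq_integral => t _.
by rewrite normal_pdfE ?oner_neq0// /normal_peak /normal_fun expr1n mul1r subr0
  mulr_natl mulNr.
Qed.

(* Main.v *)
Require Import Defs.
From HB Require Import structures.
From mathcomp Require Import all_boot all_order all_algebra.
From mathcomp Require Import all_classical all_reals all_analysis.
From mathcomp Require Import measurable_realfun.
From mathcomp Require Import ring lra.

Set Implicit Arguments.
Unset Strict Implicit.
Unset Printing Implicit Defensive.

Import Order.TTheory GRing.Theory Num.Theory.
Import numFieldNormedType.Exports.

Local Open Scope classical_set_scope.
Local Open Scope ring_scope.

(** The distribution function of a martingale is compared with [Phi] by
Lindeberg's replacement of one increment at a time, against a Gaussian
smoothing whose variance is the conditional variance still to come.

Write [X_k] for the partial sums, [v_k] for the conditional variance of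
[xi_k], [b = K * epsilon] for a large constant [K], and let
[s_k ^ 2 = b ^ 2 + (1 + delta ^ 2 - v_1 - ... - v_k)^+].  The scale [s_k] is
known at time [k - 1], is at least [b], and almost surely
[s_(k-1) ^ 2 = s_k ^ 2 + v_k].  The expectation of [Phi ((u - X_k) / s_k)]
therefore goes from [Phi (u / s_0)], which is close to [Phi u], to a smoothed
version of [P (X_n <= u)].  As [Phi (y / sqrt t)] solves the heat equation in
[(t, y)], the terms of order one and two of an increment cancel under the
conditional expectation.  By the Bernstein condition the remainder is at most
a constant times [epsilon * v_k * w (s_k, u - X_(k-1))], where
[w (s, y) = 1 / (s (s ^ 2 + y ^ 2))] ([expansion_constant_exists],
[lindeberg_increment]).

Two facts make it possible to sum these remainders.
The conditional second moment of [X_n - X_(k-1)] is at most [2 s_k ^ 2] while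
[w (s, _)] hardly varies over a distance [s]; so [X_(k-1)] may be replaced by
[X_n] ([weight_at_end]).  Then, for a fixed [y], the sum of the
[v_k * w (s_k, y)] is a Riemann sum in the variable [s ^ 2] and telescopes to
at most [12 / (b + |y|)] ([cauchy_weight_sum_le]).  The total error is thus at
most a constant times [epsilon * E (1 / (b + |u - X_n|))]
([lindeberg_total]).

Let [D] bound the uniform distance to be estimated.  An interval of
half-length [r] has probability at most [2 D + 3 r] for the law of [X_n], and
a dyadic decomposition bounds the last expectation by
[8 D / b + C |log epsilon|] ([E_inv_le]).  The factor [epsilon / b = 1 / K]
makes the coefficient of [D] small.  Removing the smoothing costs another
[D / 8] plus a multiple of [b + delta] ([smoothing_upper],
[smoothing_lower]).  Altogether the distance is at most
[D / 2 + c (epsilon |log epsilon| + delta)] ([distance_halving]), and the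
theorem follows by taking for [D] the distance itself, which is finite. *)

(** * Expectations of real random variables and conditional expectations *)

Section expectation.
Context (d : measure_display) (T : measurableType d) (R : realType).
Variable P : probability T R.
Implicit Types f g h : T -> R.

Notation intble f := (P.-integrable [set: T] (EFin \o f)).
Notation E f := (Rintegral P [set: T] f).

Lemma intble_meas f : intble f -> measurable_fun setT f.
Proof. by move=> /measurable_int/measurable_EFinP. Qed.

Lemma intbleD f g : intble f -> intble g -> intble (fun w => f w + g w).
Proof.
move=> fi gi.
by have := integrableD measurableT fi gi; apply: eq_integrable => // x _.
Qed.

Lemma intbleZ (c : R) f : intble f -> intble (fun w => c * f w).
Proof.
move=> fi.
by have := integrableZl measurableT c fi; apply: eq_integrable => // x _.
Qed.

Lemma intbleB f g : intble f -> intble g -> intble (fun w => f w - g w).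
Proof.
move=> fi gi.
by have := integrableB measurableT fi gi; apply: eq_integrable => // x _.
Qed.

Lemma intble_dom g f : measurable_fun setT f -> intble g ->
  (forall w, `|f w| <= g w) -> intble f.
Proof.
move=> mf gi fg; apply: (le_integrable measurableT _ _ gi) => [|w _ /=].
  exact/measurable_EFinP.
by rewrite lee_fin (le_trans (fg w))// ler_norm.
Qed.

Lemma intble_cst (c : R) : intble (fun=> c).
Proof. exact: finite_measure_integrable_cst. Qed.

Lemma intble_bdd (c : R) f : measurable_fun setT f ->
  (forall w, `|f w| <= c) -> intble f.
Proof. by move=> mf fc; apply: (intble_dom mf (intble_cst c)). Qed.

Lemma intble_bddM (c : R) f g : measurable_fun setT f ->
  (forall w, `|f w| <= c) -> intble g -> intble (fun w => f w * g w).
Proof.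
move=> mf fc gi; apply: (@intble_dom (fun w => c * `|g w|)).
- by apply: measurable_funM => //; exact: intble_meas.
- by apply: intbleZ; exact: integrable_norm.
- by move=> w; rewrite normrM ler_wpM2r.
Qed.

Lemma intble_sum (I : Type) (s : seq I) (F : I -> T -> R) :
  (forall i, intble (F i)) -> intble (fun w => \sum_(i <- s) F i w).
Proof.
move=> Fi; elim: s => [|i s IH].
  by under eq_fun do rewrite big_nil; exact: intble_cst.
by under eq_fun do rewrite big_cons; exact: intbleD.
Qed.

Lemma ED f g : intble f -> intble g -> E (fun w => f w + g w) = E f + E g.
Proof. exact: RintegralD. Qed.

Lemma EB f g : intble f -> intble g -> E (fun w => f w - g w) = E f - E g.
Proof. exact: RintegralB. Qed.

Lemma EZ (c : R) f : intble f -> E (fun w => c * f w) = c * E f.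
Proof. exact: RintegralZl. Qed.

Lemma Ecst (c : R) : E (fun=> c) = c.
Proof. by rewrite Rintegral_cst// (congr1 fine (probability_setT P)) mulr1.
Qed.

Lemma Esum (I : Type) (s : seq I) (F : I -> T -> R) :
  (forall i, intble (F i)) ->
  E (fun w => \sum_(i <- s) F i w) = \sum_(i <- s) E (F i).
Proof.
move=> Fi; elim: s => [|i s IH].
  by under [LHS]eq_Rintegral do rewrite big_nil; rewrite Ecst big_nil.
under [LHS]eq_Rintegral do rewrite big_cons.
by rewrite big_cons ED ?IH//; exact: intble_sum.
Qed.

Lemma ae_le_E f g : intble f -> intble g -> {ae P, forall w, f w <= g w} ->
  E f <= E g.
Proof.
move=> fi gi fg; rewrite -subr_ge0 -EB//.
have hi := intbleB gi fi.
rewrite /Rintegral (@ae_eq_integral _ _ _ P setT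
  (EFin \o (fun w => Num.max (g w - f w) 0)))//.
- by apply: fine_ge0; apply: integral_ge0 => w _; rewrite lee_fin le_max lexx orbT.
- exact: measurable_int hi.
- apply/measurable_EFinP; apply: measurable_maxr => //; exact: intble_meas hi.
- by apply: filterS fg => w fgw _ /=; rewrite max_l// subr_ge0.
Qed.

Lemma le_E f g : intble f -> intble g -> (forall w, f w <= g w) -> E f <= E g.
Proof. by move=> fi gi fg; apply: ae_le_E => //; exact: aeW. Qed.

Lemma ae_eq_E f g : intble f -> intble g -> {ae P, forall w, f w = g w} ->
  E f = E g.
Proof.
move=> fi gi fg; apply/eqP; rewrite eq_le; apply/andP; split;
  by apply: ae_le_E => //; apply: filterS fg => w ->.
Qed.

(** The defining property of a conditional expectation concerns indicator
weights; it extends to every measurable weight for which both sides make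
sense. *)
Section weighted.
Import HBSimple HBNNSimple.
Variables (G : set (set T)) (X Y : T -> R).
Hypothesis sG : sub_sigma_algebra_of G.
Hypothesis Xi : intble X.
Hypothesis XY : is_cond_exp P G X Y.

Let Yi : intble Y. Proof. by case: XY. Qed.

Let GE : (measurable : set (set (g_sigma_algebraType G))) = G.
Proof. exact: (measurable_g_measurableTypeE sG.1). Qed.

Let Q (W : T -> R) := [/\ intble (fun w => W w * X w), intble (fun w => W w * Y w) &
  E (fun w => W w * X w) = E (fun w => W w * Y w)].

Let QD W W' : Q W -> Q W' -> Q (fun w => W w + W' w).
Proof.
move=> [a b c] [a' b' c']; split.
- by under eq_fun do rewrite mulrDl; exact: intbleD.
- by under eq_fun do rewrite mulrDl; exact: intbleD.
- under eq_Rintegral do rewrite mulrDl.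
  under [RHS]eq_Rintegral do rewrite mulrDl.
  by rewrite !ED// c c'.
Qed.

Let QZ (r : R) W : Q W -> Q (fun w => r * W w).
Proof.
move=> [a b c]; split.
- by under eq_fun do rewrite -mulrA; exact: intbleZ.
- by under eq_fun do rewrite -mulrA; exact: intbleZ.
- under eq_Rintegral do rewrite -mulrA.
  under [RHS]eq_Rintegral do rewrite -mulrA.
  by rewrite !EZ// c.
Qed.

Let Q0 : Q (fun=> 0).
Proof.
split; [| |by under eq_Rintegral do rewrite mul0r;
  under [RHS]eq_Rintegral do rewrite mul0r].
  by under eq_fun do rewrite mul0r; exact: intble_cst.
by under eq_fun do rewrite mul0r; exact: intble_cst.
Qed.

Let QI A : G A -> Q (\1_A).
Proof.
move=> GA; have mA : measurable A by exact: sG.2.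
have mI : measurable_fun setT (\1_A : T -> R) by exact: measurable_indic.
have I1 w : `|\1_A w : R| <= 1 by rewrite indicE; case: (_ \in _); rewrite ?normr1 ?normr0.
have H f : intble f -> (E (fun w => \1_A w * f w) = \int[P]_(w in A) f w)%R.
  move=> fi; rewrite [RHS]Rintegral_mkcond; apply: eq_Rintegral => w _.
  by rewrite patchE indicE; case: (w \in A); rewrite ?mul1r ?mul0r.
split; [exact: intble_bddM mI I1 Xi|exact: intble_bddM mI I1 Yi|].
by rewrite !H//; rewrite /Rintegral; case: XY => _ _ ->.
Qed.

Let QS (I : Type) (s : seq I) (F : I -> T -> R) :
  (forall i, Q (F i)) -> Q (fun w => \sum_(i <- s) F i w).
Proof.
move=> QF; elim: s => [|i s IH].
  by under [X in Q X]eq_fun do rewrite big_nil.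
by under [X in Q X]eq_fun do rewrite big_cons; exact: QD.
Qed.

(** A nonnegative weight is the increasing limit of combinations of
indicators, and its product with the variable dominates the products with
the approximations. *)
Lemma E_cond_exp_ge0 (W : T -> R) : (forall w, 0 <= W w) ->
  measurable_wrt G W ->
  intble (fun w => W w * X w) -> intble (fun w => W w * Y w) ->
  E (fun w => W w * X w) = E (fun w => W w * Y w).
Proof.
move=> W0 mW WX WY.
have mW' := measurable_wrtW sG mW.
pose f : g_sigma_algebraType G -> \bar R := EFin \o W.
have mf : measurable_fun [set: g_sigma_algebraType G] f.
  exact/measurable_EFinP.
have f0 x : [set: g_sigma_algebraType G] x -> (0 <= f x)%E by rewrite lee_fin.
pose a n : T -> R := approx setT f n.
have Qa n : Q (a n).
  have GI A : measurable (A : set (g_sigma_algebraType G)) -> G A.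
    by move=> mA; rewrite -GE.
  have QB : Q (fun w => n%:R * \1_(integer_approx setT f n) w).
    by apply: QZ; apply: QI; apply: GI; exact: emeasurable_fun_c_infty.
  apply: (QD _ QB); apply: QS => k; apply: QZ; apply: QI; apply: GI.
  rewrite /dyadic_approx; case: ifPn => // _; rewrite -preimage_comp.
  by apply: mf => //; apply/measurable_image_EFin; exact: measurable_itv.
have cvga Z : measurable_fun setT Z -> intble (fun w => W w * Z w) ->
    (\int[P]_w (a n w * Z w)%:E @[n --> \oo] --> \int[P]_w (W w * Z w)%:E)%E.
  move=> mZ WZ.
  have ma n : measurable_fun [set: g_sigma_algebraType G] (a n).
    rewrite /a -(nnsfun_approxE (measurableT :
      measurable [set: g_sigma_algebraType G]) mf).
    exact: measurable_funPT.
  have [] // := @dominated_convergence _ _ _ P _ measurableT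
     (fun n w => (a n w * Z w)%:E) (fun w => (W w * Z w)%:E)
     (fun w => `|W w * Z w|%:E).
  - move=> n; apply/measurable_EFinP; apply: measurable_funM => //.
    exact: (measurable_wrtW sG (ma n)).
  - exact/measurable_EFinP/measurable_funM.
  - apply: aeW => w _; apply/cvg_EFin; first exact: nearW.
    apply: cvgM; last exact: cvg_cst.
    have := ecvg_approx f0 (I : [set: g_sigma_algebraType G] w).
    by move/fine_cvgP => [].
  - exact: integrable_norm.
  - apply: aeW => w n _; rewrite lee_fin !normrM ler_wpM2r//.
    have := le_approx n f0 (I : [set: g_sigma_algebraType G] w).
    rewrite lee_fin => H; rewrite !ger0_norm//.
    by rewrite /a /approx addr_ge0 ?sumr_ge0// => *; rewrite mulr_ge0// ?mulr_ge0.
rewrite /Rintegral; congr fine.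
have cX := cvga X (intble_meas Xi) WX.
have cY := cvga Y (intble_meas Yi) WY.
apply: (cvg_unique _ cX) => //.
apply: cvg_trans cY; apply: near_eq_cvg; apply: nearW => n.
have [QaX QaY QaE] := Qa n.
rewrite -[LHS]fineK; last exact: integrable_fin_num QaY.
by rewrite -[RHS]fineK; [congr EFin; exact: esym QaE|exact: integrable_fin_num QaX].
Qed.

(** The weight may be unbounded: the increments are tested below against
partial sums of the martingale, which are merely square integrable. *)
Lemma E_cond_exp (W : T -> R) :
  measurable_wrt G W ->
  intble (fun w => W w * X w) -> intble (fun w => W w * Y w) ->
  E (fun w => W w * X w) = E (fun w => W w * Y w).
Proof.
move=> mW WX WY.
have mW' := measurable_wrtW sG mW.
have split_ Z : intble Z -> intble (fun w => W w * Z w) -> 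
  [/\ intble (fun w => W^\+ w * Z w), intble (fun w => W^\- w * Z w) &
   E (fun w => W w * Z w) = E (fun w => W^\+ w * Z w) - E (fun w => W^\- w * Z w)].
  move=> Zi WZ.
  have mZ := intble_meas Zi.
  have i1 : intble (fun w => W^\+ w * Z w).
    apply: (@intble_dom (fun w => `|W w * Z w|)); last 2 first.
    - exact: integrable_norm.
    - move=> w; rewrite !normrM ler_wpM2r// /funrpos.
      by rewrite ger0_norm ?le_max ?lexx ?orbT// ge_max normr_ge0 ler_norm.
    - by apply: measurable_funM => //; exact: measurable_funrpos.
  have i2 : intble (fun w => W^\- w * Z w).
    apply: (@intble_dom (fun w => `|W w * Z w|)); last 2 first.
    - exact: integrable_norm.
    - move=> w; rewrite !normrM ler_wpM2r// /funrneg.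
      by rewrite ger0_norm ?le_max ?lexx ?orbT// ge_max normr_ge0 -normrN ler_norm.
    - by apply: measurable_funM => //; exact: measurable_funrneg.
  split=> //; rewrite -EB//; apply: eq_Rintegral => w _.
  by rewrite -mulrBl; congr (_ * _); rewrite -{1}(funrposBneg W).
have [a b ->] := split_ X Xi WX.
have [a' b' ->] := split_ Y Yi WY.
rewrite (@E_cond_exp_ge0 W^\+)//; first rewrite (@E_cond_exp_ge0 W^\-)//.
- exact: measurable_funrneg.
- exact: measurable_funrpos.
Qed.

End weighted.

(** Almost sure inequalities between conditional expectations are reduced to
inequalities between expectations, the weight being the indicator of the set
where the inequality fails. *)
Lemma ae_ge0_of_weighted_E (G : set (set T)) (U : T -> R) :
  sub_sigma_algebra_of G -> measurable_wrt G U -> intble U ->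
  (forall W, measurable_wrt G W -> (forall w, 0 <= W w <= 1) ->
     0 <= E (fun w => W w * U w)) ->
  {ae P, forall w, 0 <= U w}.
Proof.
move=> sG mU Ui H.
pose A : set (g_sigma_algebraType G) := [set w | U w < 0].
have mA : measurable A.
  rewrite -[A]setTI.
  have := mU measurableT `]-oo, 0%R[%classic (measurable_itv _).
  by congr measurable; apply/seteqP; split => w /=; rewrite in_itv.
have mW : measurable_wrt G (\1_A : T -> R) by exact: measurable_indic.
have : 0 <= E (fun w => \1_A w * U w).
  by apply: H => // w; rewrite indicE; case: (_ \in _); rewrite ?lexx ?ler01.
have WU w : \1_A w * U w = - U^\- w.
  rewrite indicE /funrneg; have [h|h] := boolP (w \in A).
    move: h; rewrite inE /A /= => h.
    by rewrite mul1r max_l ?opprK// oppr_ge0 ltW.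
  move: h; rewrite notin_setE /A /= => /negP; rewrite -leNgt => h.
  by rewrite mul0r max_r ?oppr0// oppr_le0.
under eq_Rintegral do rewrite WU.
have Ni : intble U^\- by exact: integrable_funrneg.
under eq_Rintegral do rewrite -mulN1r.
rewrite EZ// mulN1r oppr_ge0 => N0.
have mN := intble_meas Ni.
have /(ae_eq_integral_abs _ measurableT) : (\int[P]_w `|(U^\- w)%:E| = 0)%E.
  have -> : (\int[P]_w `|(U^\- w)%:E| = \int[P]_w (U^\- w)%:E)%E.
    by apply: eq_integral => w _; rewrite gee0_abs// lee_fin funrneg_ge0.
  apply/eqP; rewrite eq_le; apply/andP; split.
    by rewrite -[leLHS]fineK ?lee_fin//; exact: integrable_fin_num Ni.
  by apply: integral_ge0 => w _; rewrite lee_fin funrneg_ge0.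
have mN' : measurable_fun setT (EFin \o U^\-) by exact/measurable_EFinP.
move=> /(_ mN'); apply: filterS => w /(_ I) /= [].
rewrite /funrneg; have [//|Uw] := leP 0 (U w).
by rewrite max_l ?oppr_ge0 ?ltW// => /eqP; rewrite oppr_eq0 lt_eqF.
Qed.

End expectation.

(** Allows the conditional variance to be replaced by a version that is
bounded everywhere. *)
Lemma is_cond_exp_ae_eq (d : measure_display) (T : measurableType d) (R : realType)
    (P : probability T R) (G : set (set T)) (X Y Y' : T -> R) :
  sub_sigma_algebra_of G -> is_cond_exp P G X Y -> measurable_wrt G Y' ->
  P.-integrable setT (EFin \o Y') -> {ae P, forall w, Y' w = Y w} ->
  is_cond_exp P G X Y'.
Proof.
move=> sG [mY iY HY] mY' iY' YY'; split => // A GA; rewrite -HY//.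
have mA : measurable A by exact: sG.2.
apply: ae_eq_integral => //.
- by apply: measurable_funTS; exact: measurable_int iY'.
- by apply: measurable_funTS; exact: measurable_int iY.
- by apply: filterS YY' => w /= -> _.
Qed.

Lemma measurable_fun_inv (d : measure_display) (T : measurableType d)
    (R : realType) (f : T -> R) :
  (forall w, 0 <= f w) -> measurable_fun setT f ->
  measurable_fun setT (fun w => (f w)^-1).
Proof.
move=> f0 mf; under eq_fun => w do rewrite -(powR_inv1 (f0 w)).
exact: (measurableT_comp (measurable_powR _)).
Qed.

Lemma measurable_fun_sqrt (d : measure_display) (T : measurableType d)
    (R : realType) (f : T -> R) :
  (forall w, 0 <= f w) -> measurable_fun setT f ->
  measurable_fun setT (fun w => Num.sqrt (f w)).
Proof.
move=> f0 mf; under eq_fun => w do rewrite -(powR12_sqrt (f0 w)).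
exact: (measurableT_comp (measurable_powR _)).
Qed.

Lemma measurable_wrt_le (d : measure_display) (T : measurableType d)
    (R : realType) (G G' : set (set T)) (f : T -> R) :
  G `<=` G' -> measurable_wrt G f -> measurable_wrt G' f.
Proof.
move=> GG' mf _ B mB; have := mf measurableT B mB; exact: sub_sigma_algebra2.
Qed.

(** * Taylor bounds *)

(** The constants are those given by iterating the mean value theorem, hence
without the factorials of the Lagrange remainder. *)
Section taylor.
Context (R : realType).
Implicit Types a b c M : R.

Lemma derive_continuous (f f1 : R -> R) : (forall x : R, is_derive x 1 f (f1 x)) -> continuous f.
Proof.
by move=> df x; apply/differentiable_continuous/derivable1_diffP; case: (df x).
Qed.

Lemma between_norm a b c : a <= c <= b \/ b <= c <= a -> `|c - a| <= `|b - a|.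
Proof.
by move=> [] /andP[? ?]; [rewrite !ger0_norm|rewrite !ler0_norm]; lra.
Qed.

Lemma mean_value_bound (f f1 : R -> R) M a b : (forall x : R, is_derive x 1 f (f1 x)) ->
  (forall c, a <= c <= b \/ b <= c <= a -> `|f1 c| <= M) ->
  `|f b - f a| <= M * `|b - a|.
Proof.
move=> df fM.
have key x y : x <= y -> (forall c, x <= c <= y -> `|f1 c| <= M) ->
    `|f y - f x| <= M * `|y - x|.
  move=> xy fM'.
  have [|c cxy ->] := @MVT_segment _ f f1 x y xy (fun z _ => df z).
    exact/continuous_subspaceT/derive_continuous.
  by rewrite normrM ler_wpM2r//; apply: fM'; move: cxy; rewrite in_itv.
have [ab|ba] := leP a b; first by apply: key => // c cab; apply: fM; left.
rewrite distrC (distrC b); apply: key; first exact: ltW.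
by move=> c cba; apply: fM; right.
Qed.

Lemma taylor2_bound (f f1 f2 : R -> R) M a b :
  (forall x : R, is_derive x 1 f (f1 x)) -> (forall x : R, is_derive x 1 f1 (f2 x)) ->
  (forall c, a <= c <= b \/ b <= c <= a -> `|f2 c| <= M) ->
  `|f b - f a - f1 a * (b - a)| <= M * `|b - a| ^+ 2.
Proof.
move=> df df1 fM.
pose g x := f x - f1 a * x.
have dg (x : R) : is_derive x 1 g (f1 x - f1 a).
  rewrite /g.
  apply: is_derive_eq. by rewrite /GRing.scale/= mulr1.
have -> : f b - f a - f1 a * (b - a) = g b - g a by rewrite /g; ring.
rewrite expr2 mulrA; apply: (mean_value_bound dg) => c cab.
apply: (@le_trans _ _ (M * `|c - a|)).
  apply: (mean_value_bound df1) => e eac; apply: fM.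
  by move: cab eac => [] /andP[? ?] [] /andP[? ?];
    (have [?|?] := leP a b; [left|right]); apply/andP; split; lra.
rewrite ler_wpM2l//; last exact: between_norm.
apply: le_trans (fM a _) => //.
by have [?|/ltW ?] := leP a b; [left|right]; rewrite lexx ?andbT.
Qed.

Lemma taylor3_bound (f f1 f2 f3 : R -> R) M a b :
  (forall x : R, is_derive x 1 f (f1 x)) -> (forall x : R, is_derive x 1 f1 (f2 x)) ->
  (forall x : R, is_derive x 1 f2 (f3 x)) ->
  (forall c, a <= c <= b \/ b <= c <= a -> `|f3 c| <= M) ->
  `|f b - f a - f1 a * (b - a) - f2 a * (b - a) ^+ 2 / 2| <= M * `|b - a| ^+ 3.
Proof.
move=> df df1 df2 fM.
pose g x := f x - f1 a * x - f2 a / 2 * (x - a) ^+ 2.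
have dg (x : R) : is_derive x 1 g (f1 x - f1 a - f2 a * (x - a)).
  rewrite /g; apply: is_derive_eq.
  rewrite /GRing.scale/= !mulr1 ?subr0.
  by field.
have -> : f b - f a - f1 a * (b - a) - f2 a * (b - a) ^+ 2 / 2 = g b - g a.
  by rewrite /g; field.
rewrite exprSr mulrA; apply: (mean_value_bound dg) => c cab.
apply: (@le_trans _ _ (M * `|c - a| ^+ 2)).
  apply: (taylor2_bound df1 df2) => e eac; apply: fM.
  by move: cab eac => [] /andP[? ?] [] /andP[? ?];
    (have [?|?] := leP a b; [left|right]); apply/andP; split; lra.
rewrite ler_wpM2l//; last by rewrite lerXn2r ?nnegrE//; exact: between_norm.
apply: le_trans (fM a _) => //.
by have [?|/ltW ?] := leP a b; [left|right]; rewrite lexx ?andbT.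
Qed.

End taylor.

(** * The Gaussian density and distribution function *)

Section gaussian.
Context (R : realType).
Implicit Types z t w : R.

Definition phi (z : R) : R := normal_pdf 0 1 z.
Definition Phi (x : R) : R := fine (std_normal_cdf x).

Lemma phiE : phi = fun z : R => normal_peak 1 * expR (- (z ^+ 2 / 2)).
Proof.
apply/funext => z; rewrite /phi normal_pdfE ?oner_neq0//.
by rewrite /normal_fun subr0 expr1n mulNr.
Qed.

Lemma phi_ge0 z : 0 <= phi z. Proof. exact: normal_pdf_ge0. Qed.

Lemma normal_peak1_le1 : normal_peak 1 <= 1 :> R.
Proof.
rewrite /normal_peak expr1n mul1r invf_le1; last first.
  by rewrite sqrtr_gt0 mulrn_wgt0// pi_gt0.
rewrite -[leLHS]sqrtr1 ler_wsqrtr// -mulr_natr.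
by have := @pi_ge2 R; lra.
Qed.

(** Polynomial decay suffices, since the remainders of the expansions below
only have to decay like [1 / (1 + z ^ 2)].  It comes from the fourth power of
[1 + x <= exp x]. *)
Lemma phi_decay : exists2 C : R, 0 <= C &
  forall z, phi z <= C / (1 + z ^+ 2) ^+ 4.
Proof.
exists (8 ^+ 4) => [|z]; first by rewrite exprn_ge0.
have z2 : 0 <= z ^+ 2 by exact: sqr_ge0.
rewrite phiE ler_pdivlMr; last by rewrite exprn_gt0//; lra.
rewrite expRN.
have -> : z ^+ 2 / 2 = 4%:R * (z ^+ 2 / 8) by field.
rewrite expRM_natl.
have e0 : 0 < expR (z ^+ 2 / 8) ^+ 4 by rewrite exprn_gt0// expR_gt0.
rewrite mulrAC ler_pdivrMr// -exprMn.
apply: (@le_trans _ _ ((1 + z ^+ 2) ^+ 4)).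
  by rewrite ler_piMl ?normal_peak1_le1// exprn_ge0//; lra.
apply: lerXn2r; rewrite ?nnegrE; first by lra.
  by rewrite mulr_ge0// expR_ge0.
by have := expR_ge1Dx (z ^+ 2 / 8); lra.
Qed.

Lemma is_derive_phi (z : R) : is_derive z 1 phi (- (z * phi z)).
Proof.
rewrite phiE; apply: is_derive_eq.
rewrite !scaler0 add0r /GRing.scale/=.
by set e := expR _; field.
Qed.

Lemma is_derive_phi1 (z : R) :
  is_derive z 1 (fun z => - (z * phi z)) ((z ^+ 2 - 1) * phi z).
Proof.
have := is_derive_phi z => ?.
apply: is_derive_eq.
by rewrite /GRing.scale/=; ring.
Qed.

Lemma is_derive_Phi (z : R) : is_derive z 1 Phi (phi z).
Proof.
have [] := @continuous_FTC1 R phi -oo%O z (z + 1).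
- by rewrite ltrDl.
- apply: integrableS (integrable_normal_pdf 0 1) => //.
- by rewrite ltNyr.
- exact: continuous_normal_pdf.
move=> dF F'; split; first exact: dF.
by rewrite -F' derive1E.
Qed.

Lemma Phi_prob (x : R) : (Phi x)%:E = normal_prob 0 1 `]-oo, x]%classic.
Proof. by rewrite /Phi /std_normal_cdf fineK// fin_num_measure. Qed.

Lemma Phi_ge0 (x : R) : 0 <= Phi x.
Proof. by rewrite -lee_fin Phi_prob. Qed.

Lemma Phi_le1 (x : R) : Phi x <= 1.
Proof. by rewrite -lee_fin Phi_prob probability_le1. Qed.

Lemma phi_le1 z : phi z <= 1.
Proof.
apply: le_trans (_ : normal_peak 1 <= 1); last exact: normal_peak1_le1.
exact: normal_pdf_ub.
Qed.

Lemma Phi_lipschitz (x y : R) : `|Phi x - Phi y| <= `|x - y|.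
Proof.
rewrite -[leRHS]mul1r; apply: (mean_value_bound is_derive_Phi) => c _.
by rewrite ger0_norm ?phi_ge0// phi_le1.
Qed.

Lemma continuous_Phi : continuous Phi.
Proof. exact: derive_continuous is_derive_Phi. Qed.

Lemma continuous_phi : continuous phi.
Proof. exact: derive_continuous is_derive_phi. Qed.

(** Beyond [z] the density is at most [8 / z ^ 2] times the Gaussian density of
variance two, because [exp (- t ^ 2 / 4) <= 4 / t ^ 2]; the latter has total
mass one. *)
Lemma normal_tail (V : set R) z : measurable V -> 0 < z ->
  (forall t, V t -> z <= `|t|) -> (normal_prob 0 1 V <= (8 / z ^+ 2)%:E)%E.
Proof.
move=> mV z0 Vz; pose s : R := Num.sqrt 2.
have s0 : s != 0 by rewrite gt_eqF// sqrtr_gt0.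
have s2 : s ^+ 2 = 2 by rewrite sqr_sqrtr.
have z20 : 0 < z ^+ 2 by rewrite exprn_gt0.
have sle : s <= 2 by rewrite -[leRHS]ger0_norm// -sqrtr_sqr ler_wsqrtr//; lra.
have peak : normal_peak 1 = s * normal_peak s.
  rewrite /normal_peak s2 expr1n mul1r -mulrnAr sqrtrM// invfM mulrA divff//.
  by rewrite mul1r.
apply: (@le_trans _ _ (\int[lebesgue_measure]_(t in V)
   ((8 / z ^+ 2)%:E * (normal_pdf 0 s t)%:E))%E).
  apply: ge0_le_integral => //.
  - by move=> t _; rewrite lee_fin normal_pdf_ge0.
  - apply/measurable_EFinP; apply: measurable_funTS; exact: measurable_normal_pdf.
  - apply/measurable_EFinP; apply: measurable_funTS; apply: measurable_funM => //.
    exact: measurable_normal_pdf.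
  - move=> t /Vz zt; rewrite -EFinM lee_fin.
    have t2 : z ^+ 2 <= t ^+ 2.
      by move: zt; rewrite ler_normr => /orP[] h; nra.
    rewrite !normal_pdfE ?oner_neq0// /normal_fun !subr0 expr1n s2.
    have -> : - t ^+ 2 / (1 *+ 2) = - (t ^+ 2 / 4) + - t ^+ 2 / (2 *+ 2).
      by rewrite -[2 *+ 2]mulr_natr -[1 *+ 2]/2; field.
    rewrite expRD mulrA [X in _ <= X]mulrA.
    rewrite ler_wpM2r ?expR_ge0// peak mulrAC ler_wpM2r ?normal_peak_ge0//.
    rewrite expRN ler_pdivrMr ?expR_gt0//.
    apply: (@le_trans _ _ (8 / z ^+ 2 * (t ^+ 2 / 4))); last first.
      by rewrite ler_wpM2l ?divr_ge0// ?ltW//; have := expR_ge1Dx (t ^+ 2 / 4); lra.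
    apply: (le_trans sle).
    by rewrite mulrAC ler_pdivlMr//; lra.
rewrite integralZl//; last first.
  by apply: integrableS (integrable_normal_pdf 0 s).
rewrite -[leRHS]mule1 lee_wpmul2l ?lee_fin ?divr_ge0 ?sqr_ge0//.
exact: (@probability_le1 _ _ _ (normal_prob 0 s) V mV).
Qed.

Lemma Phi_tail_left z : 0 < z -> Phi (- z) <= 8 / z ^+ 2.
Proof.
move=> z0; rewrite -lee_fin Phi_prob; apply: normal_tail => // t /=.
by rewrite in_itv/= => h; rewrite ler_normr; apply/orP; right; lra.
Qed.

Lemma Phi_tail_right z : 0 < z -> 1 - Phi z <= 8 / z ^+ 2.
Proof.
move=> z0; rewrite -lee_fin EFinB Phi_prob.
rewrite -probability_setC//; apply: normal_tail => //; first exact: measurableC.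
move=> t /=; rewrite in_itv/= => /negP; rewrite -ltNge => h.
by rewrite ler_normr; apply/orP; left; lra.
Qed.

End gaussian.

(** * Expansion of the heat semigroup *)

Section expansion.
Context (R : realType).
Implicit Types z t w : R.

Lemma phi_derivatives_decay : exists2 C : R, 0 <= C &
  forall z, `|z| * phi z <= C / (1 + z ^+ 2) ^+ 3 /\
   `|(z ^+ 2 - 1) * phi z| <= C / (1 + z ^+ 2) ^+ 3.
Proof.
have [C C0 H] := phi_decay R.
exists C => // z.
have z2 : 0 <= z ^+ 2 by exact: sqr_ge0.
have q0 : 0 < 1 + z ^+ 2 by lra.
have E : C / (1 + z ^+ 2) ^+ 3 = (1 + z ^+ 2) * (C / (1 + z ^+ 2) ^+ 4).
  by field; lra.
split; rewrite E ?normrM; apply: ler_pM => //; rewrite ?phi_ge0//.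
- by have := sqr_ge0 (`|z| - 1); rewrite sqrrB real_normK ?num_real// mulr1 expr1n; lra.
- by rewrite ler_norml; apply/andP; split; lra.
- by rewrite ger0_norm ?phi_ge0.
Qed.

(** Moves the argument of [1 / (1 + z ^ 2)] at the price of a quadratic
factor. *)
Lemma peetre_inequality (z c : R) : 1 + z ^+ 2 <= 2 * (1 + c ^+ 2) * (1 + (z - c) ^+ 2).
Proof.
have := sqr_ge0 (c - (z - c)); have := mulr_ge0 (sqr_ge0 c) (sqr_ge0 (z - c)).
by nra.
Qed.

(** The supremum of the third derivative between [z] and [z - t] is moved to
[z] by Peetre's inequality, which produces the factor [1 + t ^ 2]. *)
Lemma space_expansion : exists2 C : R, 0 <= C & forall z t,
  `|Phi (z - t) - Phi z + t * phi z + t ^+ 2 / 2 * (z * phi z)| <=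
    C * (`|t| ^+ 3 * (1 + t ^+ 2)) / (1 + z ^+ 2).
Proof.
have [C C0 H] := phi_derivatives_decay.
exists (2 * C) => [|z t]; first by rewrite mulr_ge0.
have q0 x : 0 < 1 + x ^+ 2 :> R by have := sqr_ge0 x; lra.
have -> : Phi (z - t) - Phi z + t * phi z + t ^+ 2 / 2 * (z * phi z) =
   Phi (z - t) - Phi z - phi z * (z - t - z) -
     (- (z * phi z)) * (z - t - z) ^+ 2 / 2 by field.
have -> : 2 * C * (`|t| ^+ 3 * (1 + t ^+ 2)) / (1 + z ^+ 2) =
   2 * C * (1 + t ^+ 2) / (1 + z ^+ 2) * `|z - t - z| ^+ 3.
  have -> : z - t - z = - t by ring.
  by rewrite normrN; field; rewrite gt_eqF.
apply: (taylor3_bound (@is_derive_Phi R) (@is_derive_phi R) (@is_derive_phi1 R)).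
move=> c /between_norm zc; have [_ /le_trans->//] := H c.
rewrite ler_pdivlMr// mulrAC ler_pdivrMr ?exprn_gt0//.
have ct : (z - c) ^+ 2 <= t ^+ 2.
  rewrite -[(z - c) ^+ 2]ger0_norm ?sqr_ge0// -[t ^+ 2]ger0_norm ?sqr_ge0//.
  rewrite !normrX lerXn2r ?nnegrE// distrC; move: zc.
  have -> : z - t - z = - t by ring.
  by rewrite normrN.
have -> : 2 * C * (1 + t ^+ 2) * (1 + c ^+ 2) ^+ 3 =
  C * (2 * (1 + c ^+ 2) ^+ 3 * (1 + t ^+ 2)) by ring.
rewrite ler_wpM2l//.
apply: (le_trans (peetre_inequality z c)).
apply: ler_pM; rewrite ?mulr_ge0 ?(ltW (q0 _))//; last by rewrite lerD2l.
by rewrite ler_wpM2l// ler_eXnr//; have := sqr_ge0 c; lra.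
Qed.

(** Changing the variance from [1] to [1 + w] is a displacement of [z] by
[- s * z] with [s = 1 - 1 / sqrt (1 + w)], so a Taylor expansion in space
suffices: [s] is [w / 2] up to [w ^ 2], and the intermediate points have
absolute value at least [|z| / sqrt 2]. *)
Lemma time_expansion : exists2 C : R, 0 <= C & forall z w, 0 <= w <= 1 ->
  `|Phi (z / Num.sqrt (1 + w)) - Phi z + w / 2 * (z * phi z)| <=
    C * w ^+ 2 / (1 + z ^+ 2).
Proof.
have [C C0 H] := phi_derivatives_decay.
exists (9 * C) => [|z w /andP[w0 w1]]; first by rewrite mulr_ge0.
have q0 x : 0 < 1 + x ^+ 2 :> R by have := sqr_ge0 x; lra.
set r := Num.sqrt (1 + w).
have r2 : r ^+ 2 = 1 + w by rewrite sqr_sqrtr; lra.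
have r1 : 1 <= r by rewrite -[leLHS]sqrtr1 ler_wsqrtr//; lra.
have rn : r != 0 by rewrite gt_eqF//; lra.
have rr : r <= 2 by nra.
pose s := 1 - r^-1.
have s0 : 0 <= s by rewrite /s subr_ge0 invf_le1//; lra.
have wE : w = (r - 1) * (r + 1) by have := r2; rewrite expr2; lra.
have sE : s = (r - 1) / r by rewrite /s; field.
have sw : s <= w.
  by rewrite sE ler_pdivrMr; [rewrite wE; nra|lra].
have sw2 : `|w / 2 - s| <= w ^+ 2.
  have -> : w / 2 - s = w ^+ 2 * ((r + 2) / (2 * r * (r + 1) ^+ 2)).
    rewrite sE wE; field; rewrite rn /=; lra.
  rewrite normrM ger0_norm ?sqr_ge0// ler_piMr ?sqr_ge0//.
  rewrite ger0_norm; last by rewrite divr_ge0//; nra.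
  by rewrite ler_pdivrMr; nra.
have zr : z / r - z = - (s * z) by rewrite /s; field.
have -> : Phi (z / r) - Phi z + w / 2 * (z * phi z) =
  (Phi (z / r) - Phi z - phi z * (z / r - z)) + (w / 2 - s) * (z * phi z).
  by rewrite zr; ring.
apply: le_trans (ler_normD _ _) _.
have -> : 9 * C * w ^+ 2 / (1 + z ^+ 2) =
  8 * C * w ^+ 2 / (1 + z ^+ 2) + w ^+ 2 * (C / (1 + z ^+ 2)) by field; rewrite gt_eqF.
apply: lerD; last first.
  rewrite normrM; apply: ler_pM => //; rewrite normrM [`|phi z|]ger0_norm ?phi_ge0//.
  have [zz _] := H z; apply: (le_trans zz).
  rewrite ler_pdivrMr ?exprn_gt0// mulrAC ler_pdivlMr// ler_wpM2l//.
  by rewrite ler_eXnr//; have := sqr_ge0 z; lra.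
apply: (@le_trans _ _ (8 * C / (1 + z ^+ 2) ^+ 3 * `|z / r - z| ^+ 2)).
  apply: (taylor2_bound (@is_derive_Phi R) (@is_derive_phi R)) => c cz.
  rewrite normrN normrM [`|phi c|]ger0_norm ?phi_ge0//.
  have [cc _] := H c; apply: (le_trans cc).
  have c2 : 1 + z ^+ 2 <= 2 * (1 + c ^+ 2).
    have : z ^+ 2 <= (r * c) ^+ 2.
      have -> : z ^+ 2 = (r * (z / r)) ^+ 2 by congr (_ ^+ 2); field.
      rewrite !exprMn ler_wpM2l ?sqr_ge0//.
      have [z0|z0] := leP 0 z.
        have : z / r <= c /\ 0 <= z / r.
          have : z / r <= z by rewrite ler_pdivrMr ?ler_peMr//; lra.
          have : 0 <= z / r by rewrite divr_ge0//; lra.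
          by case: cz => /andP[]; lra.
        by nra.
      have : c <= z / r /\ z / r <= 0.
        have : z <= z / r by rewrite ler_pdivlMr ?ler_neMr//; [rewrite ltW|lra].
        have : z / r <= 0 by rewrite ler_pdivrMr ?mul0r ?ltW//; lra.
        by case: cz => /andP[]; lra.
      by nra.
    by rewrite exprMn r2; have := sqr_ge0 c; nra.
  rewrite ler_pdivlMr ?exprn_gt0// mulrAC ler_pdivrMr ?exprn_gt0//.
  rewrite [8 * C]mulrC -mulrA ler_wpM2l//.
  have -> : 8 * (1 + c ^+ 2) ^+ 3 = (2 * (1 + c ^+ 2)) ^+ 3 by ring.
  by rewrite lerXn2r// nnegrE; have := q0 z; have := q0 c; lra.
rewrite zr normrN real_normK ?num_real//.
rewrite [leLHS]mulrAC ler_pdivrMr ?exprn_gt0// [leRHS]mulrAC ler_pdivlMr//.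
have -> : 8 * C * (s * z) ^+ 2 * (1 + z ^+ 2) = 8 * C * (s ^+ 2 * (z ^+ 2 * (1 + z ^+ 2))) by ring.
have -> : 8 * C * w ^+ 2 * (1 + z ^+ 2) ^+ 3 = 8 * C * (w ^+ 2 * (1 + z ^+ 2) ^+ 3) by ring.
rewrite ler_wpM2l ?mulr_ge0//.
apply: ler_pM; rewrite ?sqr_ge0//.
- by rewrite mulr_ge0 ?sqr_ge0 ?ltW.
- by rewrite lerXn2r.
- by rewrite [leRHS]exprSr ler_wpM2r ?ltW//; have := sqr_ge0 z; nra.
Qed.

End expansion.

(** By the mean value theorem [|u / r - u| * phi c] is compared with
[(r - 1) * (|c| * phi c)], and [|c| * phi c] is bounded. *)
Lemma Phi_scale (R : realType) : exists2 C : R, 0 <= C &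
  forall u r : R, 1 <= r -> `|Phi (u / r) - Phi u| <= C * (r - 1).
Proof.
have [C C0 H] := phi_derivatives_decay R.
exists C => // u r r1; have r0 : 0 < r by lra.
have [->|u0] := eqVneq u 0.
  by rewrite mul0r subrr normr0 mulr_ge0//; lra.
have nu : 0 < `|u| by rewrite normr_gt0.
apply: (@le_trans _ _ (C * r / `|u| * `|u / r - u|)).
  apply: (mean_value_bound (@is_derive_Phi R)) => c cu.
  rewrite ger0_norm ?phi_ge0//.
  have uc : `|u| <= `|c| * r.
    have [up|un] := leP 0 u.
      have ur : u / r <= c.
        case: cu => /andP[? ?] //; apply: le_trans (_ : u <= _) => //.
        by rewrite ler_pdivrMr// ler_peMr.
      rewrite ger0_norm// -ler_pdivrMr//; apply: le_trans ur _; exact: ler_norm.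
    have ur : c <= u / r.
      case: cu => /andP[? ?] //; apply: le_trans (_ : u <= _) => //.
      by rewrite ler_pdivlMr// ler_neMr// ltW.
    rewrite ltr0_norm// -ler_pdivrMr// mulNr -normrN.
    by apply: le_trans (ler_norm _); rewrite lerN2.
  have cc : `|c| * phi c <= C.
    have [h _] := H c; apply: (le_trans h); rewrite ler_piMr// invf_le1.
      by rewrite exprn_ege1// lerDl sqr_ge0.
    by rewrite exprn_gt0//; have := sqr_ge0 c; lra.
  rewrite ler_pdivlMr//; apply: (@le_trans _ _ (phi c * (`|c| * r))).
    by rewrite ler_wpM2l// phi_ge0.
  by rewrite mulrA [phi c * _]mulrC ler_wpM2r// ltW.
have -> : u / r - u = u * (r^-1 - 1) by ring.
rewrite normrM distrC [`|1 - _|]ger0_norm; last by rewrite subr_ge0 invf_le1.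
by rewrite le_eqVlt; apply/orP; left; apply/eqP; field; rewrite !gt_eqF.
Qed.

(** * The weight of the Lindeberg remainder *)

Section kernel.
Context (R : realType).
Implicit Types y s v x e b : R.

Definition cauchy_weight s y : R := (s * (s ^+ 2 + y ^+ 2))^-1.

Lemma cauchy_weight_den_gt0 s y : 0 < s -> 0 < s * (s ^+ 2 + y ^+ 2).
Proof. by move=> s0; rewrite mulr_gt0// ltr_wpDr ?sqr_ge0// exprn_gt0. Qed.

Lemma cauchy_weight_ge0 s y : 0 <= s -> 0 <= cauchy_weight s y.
Proof. by move=> s0; rewrite invr_ge0 mulr_ge0// addr_ge0 ?sqr_ge0. Qed.

Lemma cauchy_weight_le b s y : 0 < b -> b <= s -> cauchy_weight s y <= (b ^+ 3)^-1.
Proof.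
move=> b0 bs; have s0 := lt_le_trans b0 bs.
rewrite lef_pV2 ?posrE ?exprn_gt0 ?cauchy_weight_den_gt0// exprS ler_pM ?sqr_ge0 ?(ltW b0)//.
have : b ^+ 2 <= s ^+ 2 by rewrite lerXn2r// nnegrE ltW.
by have := sqr_ge0 y; lra.
Qed.

(** Bounds the remainder of odd order by even powers, whose conditional
expectations the Bernstein condition controls.  The scaling in [e] makes all
three terms of the same order. *)
Lemma odd_moment_bound e s x : 0 < e -> e <= s ->
  `|x| ^+ 3 * (1 + x ^+ 2 / s ^+ 2) <= e * x ^+ 2 + x ^+ 4 / e + x ^+ 6 / e ^+ 3.
Proof.
move=> e0 es; have s0 := lt_le_trans e0 es.
pose a := `|x| / e; have a0 : 0 <= a by rewrite divr_ge0// ltW.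
have xE : `|x| = e * a by rewrite /a mulrC divfK// gt_eqF.
have x2 : x ^+ 2 = (e * a) ^+ 2 by rewrite -xE real_normK ?num_real.
have -> : x ^+ 4 = (e * a) ^+ 4 by rewrite (exprM x 2 2) x2 -exprM.
have -> : x ^+ 6 = (e * a) ^+ 6 by rewrite (exprM x 2 3) x2 -exprM.
rewrite x2 xE.
have h : (e * a) ^+ 2 / s ^+ 2 <= a ^+ 2.
  rewrite ler_pdivrMr ?exprn_gt0// exprMn mulrC ler_wpM2l ?sqr_ge0//.
  by rewrite lerXn2r// nnegrE ltW.
apply: (@le_trans _ _ ((e * a) ^+ 3 * (1 + a ^+ 2))).
  apply: ler_wpM2l; first by rewrite exprn_ge0// mulr_ge0// ltW.
  by rewrite lerD2l.
have -> : e * (e * a) ^+ 2 + (e * a) ^+ 4 / e + (e * a) ^+ 6 / e ^+ 3 =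
  e ^+ 3 * (a ^+ 2 + a ^+ 4 + a ^+ 6) by field; rewrite gt_eqF.
rewrite exprMn -mulrA ler_wpM2l ?exprn_ge0 ?(ltW e0)//.
have := mulr_ge0 (sqr_ge0 a) (sqr_ge0 (a - 1)).
have := mulr_ge0 (sqr_ge0 (a ^+ 2)) (sqr_ge0 (a - 1)).
have := sqr_ge0 a; have := sqr_ge0 (a ^+ 2); have := sqr_ge0 (a ^+ 3); nra.
Qed.

(** One increment [x] with conditional variance [v], started at distance [y]
from the threshold: space and time expansions combined.  The coefficients
of [x] and of [x ^ 2 - v] are functions of the past, so that these two terms
have mean zero. *)
Definition expansion_constant (C : R) := forall e y s v x,
  0 < e -> e <= s -> 0 <= v -> v <= 12 * e ^+ 2 -> v <= s ^+ 2 ->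
  `|Phi ((y - x) / s) - Phi (y / Num.sqrt (s ^+ 2 + v))
     + phi (y / s) / s * x + y / s * phi (y / s) / (2 * s ^+ 2) * (x ^+ 2 - v)|
  <= C * (e * x ^+ 2 + x ^+ 4 / e + x ^+ 6 / e ^+ 3 + 12 * e * v) * cauchy_weight s y.

Lemma expansion_constant_exists : exists2 C : R, 0 <= C & expansion_constant C.
Proof.
have [C1 C10 H1] := space_expansion R.
have [C2 C20 H2] := time_expansion R.
exists (C1 + C2) => [|e y s v x e0 es v0 ve vs]; first by rewrite addr_ge0.
have s0 := lt_le_trans e0 es.
have sn : s != 0 by rewrite gt_eqF.
have k0 := cauchy_weight_ge0 y (ltW s0).
have d0 : s ^+ 2 + y ^+ 2 != 0.
  by have := cauchy_weight_den_gt0 y s0; rewrite pmulr_rgt0// => /gt_eqF ->.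
pose z := y / s; pose t := x / s; pose w := v / s ^+ 2.
have w01 : 0 <= w <= 1.
  by rewrite divr_ge0 ?sqr_ge0//= ler_pdivrMr ?mul1r// exprn_gt0.
have := H1 z t; have := H2 z w w01.
have -> : z / Num.sqrt (1 + w) = y / Num.sqrt (s ^+ 2 + v).
  have -> : s ^+ 2 + v = s ^+ 2 * (1 + w) by rewrite /w; field.
  rewrite sqrtrM ?sqr_ge0// sqrtr_sqr ger0_norm ?ltW// /z invfM mulrA.
  by [].
have -> : z - t = (y - x) / s by rewrite /z /t; ring.
rewrite -/z => h2 h1.
set a := Phi ((y - x) / s); set b := Phi (y / _).
have -> : a - b + phi z / s * x + z * phi z / (2 * s ^+ 2) * (x ^+ 2 - v) =
  (a - Phi z + t * phi z + t ^+ 2 / 2 * (z * phi z)) -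
  (b - Phi z + w / 2 * (z * phi z)) by rewrite /t /w; field.
apply: (le_trans (ler_normB _ _)).
set q := e * x ^+ 2 + _ + _.
have q0 : 0 <= q.
  apply: le_trans (odd_moment_bound x e0 es).
  by rewrite mulr_ge0// addr_ge0// divr_ge0 ?sqr_ge0.
have -> : (C1 + C2) * (q + 12 * e * v) * cauchy_weight s y =
   C1 * (q + 12 * e * v) * cauchy_weight s y + C2 * (q + 12 * e * v) * cauchy_weight s y by ring.
have v12 : 0 <= 12 * e * v by rewrite !mulr_ge0// ltW.
apply: lerD.
- apply: (le_trans h1).
  have -> : C1 * (`|t| ^+ 3 * (1 + t ^+ 2)) / (1 + z ^+ 2) =
     C1 * (`|x| ^+ 3 * (1 + x ^+ 2 / s ^+ 2)) * cauchy_weight s y.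
    rewrite /t normrM normfV (ger0_norm (ltW s0)) /z /cauchy_weight.
    by field; rewrite sn d0.
  rewrite ler_wpM2r// ler_wpM2l//.
  by apply: (le_trans (odd_moment_bound x e0 es)); rewrite lerDl.
- apply: (le_trans h2).
  have -> : C2 * w ^+ 2 / (1 + z ^+ 2) = C2 * (v ^+ 2 / s) * cauchy_weight s y.
    by rewrite /w /z /cauchy_weight; field; rewrite sn d0.
  rewrite ler_wpM2r// ler_wpM2l//.
  apply: (@le_trans _ _ (12 * e * v)); last by rewrite lerDr.
  rewrite ler_pdivrMr// expr2 [leRHS]mulrAC ler_wpM2r//.
  by apply: (le_trans ve); rewrite expr2 mulrA ler_wpM2l// mulr_ge0// ltW.
Qed.

(** A lower bound of the weight at [y'] which is affine in [(y - y') ^ 2]: it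
can be averaged when only the second moment of [y - y'] is known.  It
combines Peetre's inequality with the tangent of [1 / (1 + t)] at [t = 2]. *)
Lemma cauchy_weight_shift s v y y' : 0 < s -> 0 <= v ->
  5 * (v * cauchy_weight s y) - v * cauchy_weight s y / s ^+ 2 * (y - y') ^+ 2
    <= 18 * (v * cauchy_weight s y').
Proof.
move=> s0 v0.
have s20 : 0 < s ^+ 2 by rewrite exprn_gt0.
have d0 := cauchy_weight_den_gt0 y s0; have d'0 := cauchy_weight_den_gt0 y' s0.
have q0 : 0 < s ^+ 2 + y ^+ 2 by move: d0; rewrite pmulr_rgt0.
have q'0 : 0 < s ^+ 2 + y' ^+ 2 by move: d'0; rewrite pmulr_rgt0.
pose t := (y - y') ^+ 2 / s ^+ 2.
have t0 : 0 <= t by rewrite divr_ge0 ?sqr_ge0.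
have hP : s ^+ 2 + y' ^+ 2 <= 2 * (s ^+ 2 + y ^+ 2) * (1 + t).
  have := peetre_inequality (y' / s) (y / s).
  have -> : 1 + (y' / s) ^+ 2 = (s ^+ 2 + y' ^+ 2) / s ^+ 2 by field; rewrite gt_eqF.
  have -> : 1 + (y / s) ^+ 2 = (s ^+ 2 + y ^+ 2) / s ^+ 2 by field; rewrite gt_eqF.
  have -> : 1 + (y' / s - y / s) ^+ 2 = 1 + t by rewrite /t; field; rewrite gt_eqF.
  have -> : 2 * ((s ^+ 2 + y ^+ 2) / s ^+ 2) * (1 + t) =
    2 * (s ^+ 2 + y ^+ 2) * (1 + t) / s ^+ 2 by ring.
  by rewrite ler_pM2r// invr_gt0.
have -> : 5 * (v * cauchy_weight s y) - v * cauchy_weight s y / s ^+ 2 * (y - y') ^+ 2 =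
   v * ((5 - t) * cauchy_weight s y) by rewrite /t; ring.
rewrite [leRHS]mulrCA ler_wpM2l// /cauchy_weight ler_pdivrMr// mulrAC ler_pdivlMr//.
have -> : 18 * (s * (s ^+ 2 + y ^+ 2)) = s * (18 * (s ^+ 2 + y ^+ 2)) by ring.
have -> : (5 - t) * (s * (s ^+ 2 + y' ^+ 2)) = s * ((5 - t) * (s ^+ 2 + y' ^+ 2)) by ring.
rewrite ler_wpM2l ?(ltW s0)//.
have [t5|t5] := leP t 5; last first.
  by apply: (@le_trans _ _ 0); [rewrite mulr_le0_ge0 ?ltW// subr_lt0|rewrite mulr_ge0// ltW].
apply: (@le_trans _ _ ((5 - t) * (2 * (s ^+ 2 + y ^+ 2) * (1 + t)))).
  by rewrite ler_wpM2l// subr_ge0.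
have -> : (5 - t) * (2 * (s ^+ 2 + y ^+ 2) * (1 + t)) =
  (2 * ((5 - t) * (1 + t))) * (s ^+ 2 + y ^+ 2) by ring.
rewrite ler_wpM2r ?(ltW q0)//.
by have := sqr_ge0 (t - 2); nra.
Qed.

(** The function [- 1 / (sqrt a + |y|)] of [a = s ^ 2] has derivative
[1 / (2 sqrt a (sqrt a + |y|) ^ 2)], which is at least a quarter of the
weight; the condition [v <= s ^ 2] allows a full step of length [v]. *)
Lemma cauchy_weight_telescope s v y : 0 < s -> 0 <= v -> v <= s ^+ 2 ->
  v * cauchy_weight s y <= 12 * ((s + `|y|)^-1 - (Num.sqrt (s ^+ 2 + v) + `|y|)^-1).
Proof.
move=> s0 v0 vs; set s' := Num.sqrt _.
have s'2 : s' ^+ 2 = s ^+ 2 + v by rewrite sqr_sqrtr// addr_ge0 ?sqr_ge0.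
have ss' : s <= s'.
  by rewrite -[s]ger0_norm ?(ltW s0)// -sqrtr_sqr ler_wsqrtr// lerDl.
have s'0 := lt_le_trans s0 ss'.
have s's : s' <= 2 * s by nra.
have vE : v = (s' - s) * (s' + s) by have := s'2; rewrite !expr2; lra.
have y0 := normr_ge0 y; have y2 : y ^+ 2 = `|y| ^+ 2 by rewrite real_normK ?num_real.
rewrite /cauchy_weight y2; move: (`|y|) y0 {y2} => {}y y0.
pose D := (s' + s) * ((s + y) * (s' + y)).
have D0 : 0 < D by rewrite !mulr_gt0//; lra.
have d0 : 0 < s * (s ^+ 2 + y ^+ 2).
  by rewrite mulr_gt0// ltr_wpDr ?sqr_ge0// exprn_gt0.
have -> : 12 * ((s + y)^-1 - (s' + y)^-1) = v * (12 / D).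
  by rewrite vE /D; field; rewrite !gt_eqF//; lra.
rewrite ler_wpM2l// ler_pdivlMr// mulrC ler_pdivrMr//.
apply: (@le_trans _ _ ((3 * s) * (2 * (s + y) ^+ 2))).
  apply: ler_pM; rewrite ?mulr_ge0//; try lra.
  have -> : 2 * (s + y) ^+ 2 = (s + y) * (2 * (s + y)) by ring.
  by apply: ler_wpM2l; lra.
have -> : 3 * s * (2 * (s + y) ^+ 2) = s * (6 * (s + y) ^+ 2) by ring.
have -> : 12 * (s * (s ^+ 2 + y ^+ 2)) = s * (12 * (s ^+ 2 + y ^+ 2)) by ring.
by rewrite ler_wpM2l ?(ltW s0)//; have := sqr_ge0 (s - y); nra.
Qed.

Lemma cauchy_weight_sum_le (n : nat) (s v : nat -> R) b y : 0 < b ->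
  (forall k, (k <= n)%N -> b <= s k) ->
  (forall k, (k < n)%N -> 0 <= v k.+1 <= s k.+1 ^+ 2) ->
  (forall k, (k < n)%N -> s k = Num.sqrt (s k.+1 ^+ 2 + v k.+1)) ->
  \sum_(k < n) v k.+1 * cauchy_weight (s k.+1) y <= 12 * (b + `|y|)^-1.
Proof.
move=> b0 bs vs sE; have y0 := normr_ge0 y.
pose g k := (s k + `|y|)^-1.
apply: (@le_trans _ _ (\sum_(k < n) 12 * (g k.+1 - g k))).
  apply: ler_sum => k _; rewrite /g (sE k)//.
  have /andP[v0 vs'] := vs k (ltn_ord k).
  by apply: cauchy_weight_telescope => //; exact: lt_le_trans b0 (bs _ _).
rewrite -mulr_sumr ler_wpM2l//.
have -> : \sum_(k < n) (g k.+1 - g k) = g n - g 0%N.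
  by rewrite -(telescope_sumr _ (leq0n n)) big_mkord.
have s0 k : (k <= n)%N -> 0 < s k + `|y|.
  by move=> kn; rewrite ltr_pwDl// (lt_le_trans b0)// bs.
apply: (@le_trans _ _ (g n)).
  by rewrite gerBl invr_ge0 ltW// s0.
by rewrite lef_pV2 ?posrE ?s0//; [rewrite lerD2r bs|rewrite ltr_pwDl].
Qed.

(** The [m]-th term of the sum accounts for [|y|] of order [b * 2 ^ m], and
the last term for what lies beyond [b * 2 ^ M]. *)
Lemma dyadic_bound b y (M p : nat) : 0 < b ->
  (b + `|y|)^-1 ^+ p <=
  \sum_(m < M) (2 / (b * 2 ^+ m)) ^+ p * (`|y| <= b * 2 ^+ m)%R%:R
    + (2 / (b * 2 ^+ M)) ^+ p.
Proof.
move=> b0; have y0 := normr_ge0 y.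
have inv0 : 0 <= (b + `|y|)^-1 by rewrite invr_ge0; lra.
elim: M => [|M IH].
  rewrite big_ord0 add0r expr0 mulr1.
  apply: lerXn2r; rewrite ?nnegrE//; first by rewrite divr_ge0// ltW.
  rewrite -div1r ler_pdivrMr; last by lra.
  by rewrite mulrAC ler_pdivlMr//; lra.
rewrite big_ord_recr/=.
have t0 m : 0 < 2 / (b * 2 ^+ m) by rewrite divr_gt0// mulr_gt0// exprn_gt0.
have S0 : 0 <= \sum_(m < M) (2 / (b * 2 ^+ m)) ^+ p * (`|y| <= b * 2 ^+ m)%R%:R.
  by apply: sumr_ge0 => m _; rewrite mulr_ge0// exprn_ge0// ltW.
have [yM|yM] := leP `|y| (b * 2 ^+ M).
  by rewrite mulr1; apply: (le_trans IH); rewrite lerDl exprn_ge0// ltW.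
rewrite mulr0 addr0; apply: ler_wpDl => //.
apply: lerXn2r; rewrite ?nnegrE//; first exact/ltW.
have b20 : 0 < b * 2 ^+ M by rewrite mulr_gt0// exprn_gt0.
have -> : 2 / (b * 2 ^+ M.+1) = (b * 2 ^+ M)^-1.
  by rewrite exprS; field; rewrite !gt_eqF ?exprn_gt0.
by rewrite lef_pV2 ?posrE//; lra.
Qed.

End kernel.

Lemma geometric_sum_le2 (R : realType) (M : nat) :
  \sum_(m < M) (2 ^+ m)^-1 <= 2 :> R.
Proof.
suff -> : \sum_(m < M) (2 ^+ m)^-1 = 2 - 2 * (2 ^+ M)^-1 :> R.
  by rewrite gerBl mulr_ge0// invr_ge0 exprn_ge0.
elim: M => [|M IH]; first by rewrite big_ord0 expr0; field.
by rewrite big_ord_recr/= IH exprS; field; rewrite expf_neq0.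
Qed.

Lemma measurable_cauchy_weight (d : measure_display) (T : measurableType d)
    (R : realType) (f g : T -> R) : (forall w, 0 < f w) ->
  measurable_fun setT f -> measurable_fun setT g ->
  measurable_fun setT (fun w => cauchy_weight (f w) (g w)).
Proof.
move=> f0 mf mg; apply: measurable_fun_inv => [w|].
  exact/ltW/cauchy_weight_den_gt0.
by apply: measurable_funM => //; apply: measurable_funD; exact: measurable_funX.
Qed.

(** * Laws at uniform distance D from the Gaussian law *)

Section concentration.
Context (d : measure_display) (T : measurableType d) (R : realType).
Variables (P : probability T R) (X : T -> R) (D : R).
Hypothesis mX : measurable_fun [set: T] X.
Notation intble f := (P.-integrable [set: T] (EFin \o f)).
Notation E f := (Rintegral P [set: T] f).

Lemma E_bool (b : T -> bool) : measurable [set w | b w] ->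
  intble (fun w => (b w)%:R) /\ E (fun w => (b w)%:R) = fine (P [set w | b w]).
Proof.
move=> mb; have e : (fun w => (b w)%:R : R) = \1_[set w | b w].
  by apply/funext => w; rewrite indicE mem_setE.
rewrite e; split.
  apply: (@intble_bdd _ _ _ P 1) => // w.
  by rewrite indicE; case: (_ \in _); rewrite ?normr1 ?normr0.
by rewrite /Rintegral integral_indic// setIT.
Qed.

Lemma measurable_le_fun (f g : T -> R) : measurable_fun setT f -> measurable_fun setT g ->
  measurable [set w | f w <= g w].
Proof.
move=> mf mg; by have := measurable_fun_le measurableT mf mg; rewrite setTI.
Qed.

Lemma intble_inv (b u : R) (p : nat) : 0 < b ->
  intble (fun w => (b + `|u - X w|)^-1 ^+ p).
Proof.
move=> b0; apply: (@intble_bdd _ _ _ P (b^-1 ^+ p)).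
  apply: measurable_funX.
  apply: measurable_fun_inv => [w|]; first by rewrite addr_ge0// ltW.
  apply: measurable_funD => //; apply: measurableT_comp => //.
  exact: measurable_funB.
move=> w; have y0 := normr_ge0 (u - X w).
have p0 : 0 <= (b + `|u - X w|)^-1 by rewrite invr_ge0; lra.
rewrite ger0_norm ?exprn_ge0// lerXn2r ?nnegrE// ?invr_ge0 ?(ltW b0)//.
by rewrite lef_pV2 ?posrE//; lra.
Qed.

Hypothesis FD : forall x, `|fine (P [set w | X w <= x]) - Phi x| <= D.

(** The Gaussian law gives mass at most [3 r] to the half-open interval from
[u - 2 r] to [u + r]; the left end is moved from [u - r] to [u - 2 r] so as
to keep a possible atom of [X] at [u - r]. *)
Lemma ball_concentration (u r : R) : 0 < r ->
  fine (P [set w | `|u - X w| <= r]) <= 2 * D + 3 * r.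
Proof.
move=> r0.
have mF x : measurable [set w | X w <= x] by exact: measurable_le_fun.
have [i1 e1] := E_bool (mF (u + r)).
have [i2 e2] := E_bool (mF (u - 2 * r)).
have mB : measurable [set w | `|u - X w| <= r].
  apply: measurable_le_fun => //; apply: measurableT_comp => //.
  exact: measurable_funB.
have [i3 e3] := E_bool mB.
have : fine (P [set w | `|u - X w| <= r]) <=
    fine (P [set w | X w <= u + r]) - fine (P [set w | X w <= u - 2 * r]).
  rewrite -e1 -e2 -e3 -EB//; apply: le_E => //; first exact: intbleB.
  move=> w; case: (leP `|u - X w| r) => [|_].
    rewrite ler_norml => /andP[h1 h2].
    have -> : X w <= u + r by lra.
    by rewrite [X w <= u - 2 * r]lt_geF ?subr0//; lra.
  case: (leP (X w) (u - 2 * r)) => h; last by rewrite subr0.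
  have -> : X w <= u + r by lra.
  by rewrite subrr.
have := FD (u + r); have := FD (u - 2 * r).
have := Phi_lipschitz (u + r) (u - 2 * r).
have -> : u + r - (u - 2 * r) = 3 * r by ring.
rewrite [`|3 * r|]ger0_norm; last by lra.
by rewrite !ler_norml; lra.
Qed.

Lemma E_inv_dyadic (b u : R) (M p : nat) : 0 < b ->
  E (fun w => (b + `|u - X w|)^-1 ^+ p) <=
  \sum_(m < M) (2 / (b * 2 ^+ m)) ^+ p * (2 * D + 3 * (b * 2 ^+ m))
    + (2 / (b * 2 ^+ M)) ^+ p.
Proof.
move=> b0.
have bm m : 0 < b * 2 ^+ m by rewrite mulr_gt0// exprn_gt0.
have mB m : measurable [set w | `|u - X w| <= b * 2 ^+ m].
  apply: measurable_le_fun => //; apply: measurableT_comp => //.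
  exact: measurable_funB.
have im m : intble (fun w => (2 / (b * 2 ^+ m)) ^+ p * (`|u - X w| <= b * 2 ^+ m)%R%:R).
  by apply: intbleZ; exact: (E_bool (mB m)).1.
apply: (@le_trans _ _ (E (fun w => \sum_(m < M) (2 / (b * 2 ^+ m)) ^+ p *
   (`|u - X w| <= b * 2 ^+ m)%R%:R + (2 / (b * 2 ^+ M)) ^+ p))).
  apply: le_E => [||w]; last exact: dyadic_bound.
    exact: intble_inv.
  by apply: intbleD; [exact: intble_sum|exact: intble_cst].
rewrite ED; [|exact: intble_sum|exact: intble_cst].
rewrite Ecst Esum// lerD2r; apply: ler_sum => m _.
have [i e] := E_bool (mB m).
rewrite EZ// e ler_wpM2l ?ball_concentration//.
by rewrite exprn_ge0// divr_ge0// ltW.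
Qed.

(** The parts proportional to [D] form a geometric series, whereas the Gaussian
part is the same for each of the [M] dyadic scales: this is the source of the
logarithm. *)
Lemma E_inv_le (b u : R) (M : nat) : 0 < b ->
  E (fun w => (b + `|u - X w|)^-1) <= 8 * D / b + 6 * M%:R + 2 / (b * 2 ^+ M).
Proof.
move=> b0; have := E_inv_dyadic u M 1 b0.
under [X in X <= _ -> _]eq_Rintegral do rewrite expr1.
rewrite expr1 => /le_trans; apply; rewrite lerD2r.
have D0 : 0 <= D := le_trans (normr_ge0 _) (FD 0).
rewrite (eq_bigr (fun m : 'I_M => 4 * D / b * (2 ^+ m)^-1 + 6)); last first.
  by move=> m _; rewrite expr1; field; rewrite !gt_eqF ?exprn_gt0.
rewrite big_split/= -mulr_sumr sumr_const card_ord -[6 *+ M]mulr_natr.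
rewrite lerD2r (_ : 8 * D / b = 4 * D / b * 2); last by ring.
by rewrite ler_wpM2l ?geometric_sum_le2// divr_ge0 ?mulr_ge0// ltW.
Qed.

(** With the square, the dyadic contributions decay geometrically and no
logarithm appears; the number of scales is taken large enough for the last
term to be below [1 / b]. *)
Lemma E_inv_sqr_le (b u : R) : 0 < b ->
  E (fun w => (b + `|u - X w|)^-1 ^+ 2) <= 16 * D / b ^+ 2 + 25 / b.
Proof.
move=> b0.
pose M := (Num.truncn (4 / b)).+1.
have M4 : 4 / b <= 2 ^+ M.
  have /ltW/le_trans := truncnS_gt (4 / b); apply.
  by rewrite -natrX ler_nat ltnW// ltn_expl.
have p2 m : 0 < 2 ^+ m :> R by rewrite exprn_gt0.
have := E_inv_dyadic u M 2 b0 => /le_trans; apply.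
have D0 : 0 <= D := le_trans (normr_ge0 _) (FD 0).
have -> : 16 * D / b ^+ 2 + 25 / b = (16 * D / b ^+ 2 + 24 / b) + 1 / b by field; rewrite gt_eqF.
apply: lerD; last first.
  have -> : (2 / (b * 2 ^+ M)) ^+ 2 = (4 / b) * (b * 2 ^+ M ^+ 2)^-1.
    by field; rewrite !gt_eqF.
  rewrite -ler_pdivlMr ?invr_gt0 ?mulr_gt0 ?exprn_gt0// invrK.
  have -> : 1 / b * (b * 2 ^+ M ^+ 2) = 2 ^+ M * 2 ^+ M by field; rewrite gt_eqF.
  rewrite -[leLHS]mulr1 ler_pM ?divr_ge0 ?(ltW b0)//.
  by rewrite exprn_ege1// ler1n.
have -> : 16 * D / b ^+ 2 + 24 / b = (8 * D / b ^+ 2 + 12 / b) * 2 by ring.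
apply: (@le_trans _ _ ((8 * D / b ^+ 2 + 12 / b) * \sum_(m < M) (2 ^+ m)^-1)); last first.
  by rewrite ler_wpM2l ?geometric_sum_le2// addr_ge0 ?divr_ge0 ?mulr_ge0 ?sqr_ge0 ?(ltW b0).
rewrite mulr_sumr; apply: ler_sum => m _.
have -> : (2 / (b * 2 ^+ m)) ^+ 2 * (2 * D + 3 * (b * 2 ^+ m)) =
  8 * D / b ^+ 2 * ((2 ^+ m)^-1 * (2 ^+ m)^-1) + 12 / b * (2 ^+ m)^-1.
  by field; rewrite !gt_eqF.
rewrite [leRHS]mulrDl lerD2r ler_wpM2l ?divr_ge0 ?mulr_ge0 ?sqr_ge0 ?(ltW b0)//.
rewrite ler_piMl ?invr_ge0 ?(ltW (p2 m))// invf_le1//.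
by rewrite exprn_ege1// ler1n.
Qed.

(** The smoothing scale [S] may be random and may depend on [X]: shifting the threshold by [a * s] leaves an error governed by the Gaussian
tail at distance [a * s + |u - X|], hence by the inverse square of the latter.
The coefficient of [D] is small when [a] is large. *)
Section smoothing.
Variables (S : T -> R) (s a : R).
Hypothesis mS : measurable_fun [set: T] S.
Hypothesis S0 : forall w, 0 < S w.
Hypothesis Ss : {ae P, forall w, S w <= s}.
Hypothesis s0 : 0 < s.
Hypothesis a0 : 0 < a.

Lemma intble_PhiS (u : R) : intble (fun w => Phi ((u - X w) / S w)).
Proof.
apply: (@intble_bdd _ _ _ P 1).
  apply: (measurableT_comp (f := @Phi R)).
    exact: (continuous_measurable_fun (@continuous_Phi R)).
  apply: measurable_funM; first exact: measurable_funB.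
  by apply: measurable_fun_inv => // w; exact: ltW.
by move=> w; rewrite ger0_norm ?Phi_ge0 ?Phi_le1.
Qed.

Let tail_le (y : R) (w : T) : 0 <= y -> S w <= s ->
  8 / ((a * s + y) / S w) ^+ 2 <= 8 * s ^+ 2 * (a * s + y)^-1 ^+ 2.
Proof.
move=> y0 Sw; have as0 : 0 < a * s by rewrite mulr_gt0.
have -> : 8 / ((a * s + y) / S w) ^+ 2 =
   8 * S w ^+ 2 * (a * s + y)^-1 ^+ 2.
  by field; rewrite !gt_eqF//; lra.
rewrite ler_wpM2r ?exprn_ge0 ?invr_ge0//; first by lra.
by rewrite ler_wpM2l// lerXn2r// nnegrE ltW.
Qed.

Let b0 : 0 < a * s. Proof. by rewrite mulr_gt0. Qed.

Let intt (u : R) : intble (fun w => 8 * s ^+ 2 * (a * s + `|u - X w|)^-1 ^+ 2).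
Proof. by apply: intbleZ; exact: intble_inv. Qed.

Let Et (u : R) : E (fun w => 8 * s ^+ 2 * (a * s + `|u - X w|)^-1 ^+ 2) <=
  128 * D / a ^+ 2 + 200 * s / a.
Proof.
rewrite EZ; last exact: intble_inv.
have -> : 128 * D / a ^+ 2 + 200 * s / a =
   8 * s ^+ 2 * (16 * D / (a * s) ^+ 2 + 25 / (a * s)) by field; rewrite !gt_eqF.
by rewrite ler_wpM2l ?E_inv_sqr_le// mulr_ge0// sqr_ge0.
Qed.

Let mF x : measurable [set w | X w <= x].
Proof. exact: measurable_le_fun. Qed.

Lemma smoothing_upper (u : R) : fine (P [set w | X w <= u]) <=
  E (fun w => Phi ((u + a * s - X w) / S w)) + (128 * D / a ^+ 2 + 200 * s / a).
Proof.
have [i e] := E_bool (mF u); rewrite -e.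
apply: (@le_trans _ _ (E (fun w => Phi ((u + a * s - X w) / S w) +
   8 * s ^+ 2 * (a * s + `|u - X w|)^-1 ^+ 2))); last first.
  by rewrite ED//; [rewrite lerD2l|exact: intble_PhiS].
apply: ae_le_E => //; first by apply: intbleD => //; exact: intble_PhiS.
apply: filterS Ss => w Sw.
have t0 : 0 <= 8 * s ^+ 2 * (a * s + `|u - X w|)^-1 ^+ 2.
  by apply: mulr_ge0; [apply: mulr_ge0|]; rewrite ?sqr_ge0.
have [h|h] := leP (X w) u; last by rewrite addr_ge0// Phi_ge0.
rewrite -lerBlDl.
have -> : u + a * s - X w = a * s + `|u - X w|.
  by rewrite ger0_norm; [ring|lra].
apply: le_trans (tail_le _ Sw) => //; apply: Phi_tail_right.
by rewrite divr_gt0//; apply: ltr_wpDr.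
Qed.

Lemma smoothing_lower (u : R) :
  E (fun w => Phi ((u - a * s - X w) / S w)) - (128 * D / a ^+ 2 + 200 * s / a)
  <= fine (P [set w | X w <= u]).
Proof.
have [i e] := E_bool (mF u); rewrite -e lerBlDr.
apply: (@le_trans _ _ (E (fun w => (X w <= u)%R%:R +
   8 * s ^+ 2 * (a * s + `|u - X w|)^-1 ^+ 2))); last first.
  by rewrite ED// lerD2l.
apply: ae_le_E => //; [exact: intble_PhiS|exact: intbleD|].
apply: filterS Ss => w Sw.
have t0 : 0 <= 8 * s ^+ 2 * (a * s + `|u - X w|)^-1 ^+ 2.
  by apply: mulr_ge0; [apply: mulr_ge0|]; rewrite ?sqr_ge0.
have [h|h] := leP (X w) u; first by apply: ler_wpDr => //; exact: Phi_le1.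
rewrite add0r.
have -> : u - a * s - X w = - (a * s + `|u - X w|).
  by rewrite ltr0_norm; [ring|lra].
apply: le_trans (tail_le _ Sw) => //; rewrite mulNr; apply: Phi_tail_left.
by rewrite divr_gt0//; apply: ltr_wpDr.
Qed.

End smoothing.
End concentration.

(** * Real estimates for the final bounds *)

Lemma norm_mul_le (R : realType) (x y : R) : `|x * y| <= x ^+ 2 + y ^+ 2.
Proof.
by rewrite ler_norml; apply/andP; split; have := sqr_ge0 (x + y);
  have := sqr_ge0 (x - y); nra.
Qed.

(** [B4] and [B6] stand for the weighted moments of order four and six, [A]
for the weighted variance; [385 = 1 + 12 + 360 + 12]. *)
Lemma moment_sum_le (R : realType) (C B e A B4 B6 : R) : 0 <= C -> B = 385 * C -> 0 < e ->
  B4 <= 12 * e ^+ 2 * A -> B6 <= 360 * e ^+ 4 * A ->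
  C * (e * A + e^-1 * B4 + (e ^+ 3)^-1 * B6 + 12 * e * A) <= B * e * A.
Proof.
move=> C0 -> e0 h4 h6.
have -> : 385 * C * e * A = C * (e * A + 12 * e * A + 12 * e * A + 360 * e * A).
  by ring.
apply: ler_wpM2l => //.
have : e^-1 * B4 <= 12 * e * A.
  by rewrite mulrC ler_pdivrMr//; apply: (le_trans h4); lra.
have : (e ^+ 3)^-1 * B6 <= 360 * e * A.
  rewrite mulrC ler_pdivrMr ?exprn_gt0//; apply: (le_trans h6).
  by have -> : 360 * e * A * e ^+ 3 = 360 * e ^+ 4 * A by ring.
by lra.
Qed.

(** The number of dyadic scales between [e] and [1].  The base-two exponent is
obtained from [2 >= exp (1 / 2)]. *)
Lemma log_scale (R : realType) (e : R) : 0 < e <= 2^-1 ->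
  2^-1 <= `|ln e| /\
  exists M : nat, e^-1 <= 2 ^+ M /\ M%:R <= 4 * `|ln e|.
Proof.
move=> /andP[e0 e2].
have L1 : ln e <= - 2^-1.
  have h : expR (ln e) = e by rewrite lnK.
  have := expR_ge1Dx (ln e); rewrite h; lra.
have LE : `|ln e| = - ln e by rewrite ler0_norm//; lra.
rewrite LE; split; first by lra.
have t0 : 0 <= 2 * - ln e by lra.
exists (Num.truncn (2 * - ln e)).+1; split.
  have h : 2 * - ln e <= (Num.truncn (2 * - ln e)).+1%:R by exact/ltW/truncnS_gt.
  set M := (Num.truncn _).+1 in h *.
  have -> : e^-1 = expR (- ln e) by rewrite expRN lnK.
  apply: (@le_trans _ _ (expR (M%:R * 2^-1))); first by rewrite ler_expR; lra.
  rewrite expRM_natl lerXn2r ?nnegrE ?expR_ge0//.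
  have := expR_ge1Dx (- 2^-1 : R); rewrite expRN => h2.
  have p := expR_gt0 (2^-1 : R).
  have : (2^-1 : R) <= (expR 2^-1)^-1 by lra.
  by rewrite lef_pV2 ?posrE.
have /andP[h _] := truncn_itv t0; rewrite -natr1; lra.
Qed.

(** Sums the four sources of error: the Lindeberg remainders [H * e * q], the
rescaling of [Phi] by [1 + r], the shift of the threshold by [32 * s] and the
Gaussian tails; [tM] stands for [2 ^ (- M)].  The choice [K >= 64 H] brings
the contribution of [D] in the first one down to [D / 8]. *)
Lemma error_budget (R : realType) (D H K C1 e L delta b s r M tM q : R) :
  0 <= D -> 0 <= H -> 0 <= C1 -> 0 < e <= 2^-1 -> 2^-1 <= L -> 0 <= delta <= 2^-1 ->
  K = 4 + 64 * H -> b = K * e -> s = b + 2 * delta ->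
  M <= 4 * L -> 0 < tM -> tM <= e ->
  r <= b ^+ 2 + delta ^+ 2 ->
  q <= 8 * D / b + 6 * M + 2 / b * tM ->
  H * e * q + C1 * r + 32 * s + (8^-1 * D + 8 * s) <=
  D / 2 + (80 * (K + 1) + 24 * H + 2 + C1 * (K ^+ 2 + 1)) * (e * L + delta).
Proof.
move=> D0 H0 C10 /andP[e0 e2] L2 /andP[d0 d2] KE bE sE ML tM0 tMe rle qle.
have K4 : 4 <= K by rewrite KE; lra.
have K0 : 0 < K by lra.
have HK : 64 * H <= K by rewrite KE; lra.
have e2L : e <= 2 * (e * L) by rewrite mulrCA -[leLHS]mulr1 ler_pM2l//; lra.
have h1 : H * e * q <= D / 8 + 24 * H * (e * L) + e * L.
  apply: (@le_trans _ _ (H * e * (8 * D / b + 6 * M + 2 / b * tM))).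
    by rewrite ler_wpM2l// mulr_ge0// ltW.
  have -> : H * e * (8 * D / b + 6 * M + 2 / b * tM) =
     8 * H / K * D + 6 * H * e * M + 2 * H / K * tM.
    by rewrite bE; field; rewrite !gt_eqF.
  have i1 : 8 * H / K * D <= 8^-1 * D.
    by rewrite ler_wpM2r// ler_pdivrMr//; lra.
  have i2 : 6 * H * e * M <= 6 * H * e * (4 * L).
    by apply: ler_wpM2l => //; rewrite !mulr_ge0// ltW.
  have i3 : 2 * H / K * tM <= 1 / 2 * e.
    apply: ler_pM; rewrite ?(ltW tM0)//; first by rewrite divr_ge0 ?mulr_ge0// ltW.
    by rewrite ler_pdivrMr//; lra.
  by lra.
have h2 : C1 * r <= C1 * (K ^+ 2 + 1) * (e * L + delta).
  rewrite -mulrA; apply: ler_wpM2l => //; apply: (le_trans rle).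
  have ee : e ^+ 2 <= e * L by rewrite expr2 ler_pM2l//; lra.
  have dd : delta ^+ 2 <= delta by rewrite expr2 ler_piMr//; lra.
  have eL : 0 <= e * L by rewrite mulr_ge0//; lra.
  rewrite bE exprMn.
  have : K ^+ 2 * e ^+ 2 <= K ^+ 2 * (e * L) by rewrite ler_wpM2l// sqr_ge0.
  have : 0 <= K ^+ 2 * delta by rewrite mulr_ge0// sqr_ge0.
  by lra.
have h3 : 40 * s <= 80 * (K + 1) * (e * L + delta).
  have Ke : K * e <= K * (2 * (e * L)) by rewrite ler_pM2l.
  have eL : 0 <= e * L by rewrite mulr_ge0//; lra.
  have : 0 <= K * delta by rewrite mulr_ge0// ltW.
  by rewrite sE bE; lra.
have h4 : 0 <= 24 * H * delta by rewrite mulr_ge0// mulr_ge0.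
have : 0 <= e * L by rewrite mulr_ge0//; lra.
by lra.
Qed.

Lemma smoothing_error_le (R : realType) (D s : R) : 0 < s ->
  128 * D / 32 ^+ 2 + 200 * s / 32 <= 8^-1 * D + 8 * s.
Proof.
move=> s0; have -> : 128 * D / 32 ^+ 2 = 8^-1 * D by field.
by rewrite lerD2l ler_pdivrMr//; lra.
Qed.

Lemma sandwich_le (R : realType) (F p E1 E2 B t t' : R) :
  `|E1 - p| <= B -> `|E2 - p| <= B -> F <= E1 + t -> E2 - t <= F -> t <= t' ->
  `|F - p| <= B + t'.
Proof. by rewrite !ler_norml => /andP[? ?] /andP[? ?] *; apply/andP; split; lra. Qed.

(** * Conditional moments of the increments *)

Section martingale.
Context (d : measure_display) (T : measurableType d) (R : realType).
Variables (P : probability T R) (n : nat) (F : nat -> set (set T)).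
Variables (xi : nat -> T -> R) (e : R).
Hypothesis md : martingale_difference P n F xi.
Hypothesis bc : bernstein_condition P n F xi e.
Hypothesis e_gt0 : 0 < e.
Notation intble f := (P.-integrable [set: T] (EFin \o f)).
Notation E f := (Rintegral P [set: T] f).

Lemma filtration_le i j : (i <= j <= n)%N -> F i `<=` F j.
Proof.
move=> /andP[ij jn]; elim: j ij jn => [|j IH].
  by rewrite leqn0 => /eqP -> _; exact: subset_refl.
rewrite leq_eqVlt => /predU1P[-> _|]; first exact: subset_refl.
rewrite ltnS => ij jn.
exact: (subset_trans (IH ij (ltnW jn)) (md_filtration md jn)).
Qed.

Let pred_le i : (1 <= i <= n)%N -> (i.-1 <= n)%N.
Proof. by move=> /andP[_]; apply: leq_trans; exact: leq_pred. Qed.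

Lemma sub_pred i : (1 <= i <= n)%N -> sub_sigma_algebra_of (F i.-1).
Proof. by move=> /pred_le; exact: (md_sigma md). Qed.

Lemma measurable_xi i : (1 <= i <= n)%N -> measurable_fun [set: T] (xi i).
Proof.
move=> /andP[_ i_n].
exact: (measurable_wrtW (md_sigma md i_n) (md_adapted md i_n)).
Qed.

Lemma intble_xiX k i : (1 <= i <= n)%N -> intble (fun w => xi i w ^+ k).
Proof.
move=> i1n; have i_n : (i <= n)%N by case/andP: i1n.
have mX := measurable_xi i1n.
have i2 : intble (fun w => xi i w ^+ 2) by exact: (Lfun2_integrable_sqr (md_square md i_n)).
case: k => [|[|[|k]]] //; last by have [] := bc (isT : (3 <= k.+3)%N) i1n.
  by under eq_fun do rewrite expr0; exact: intble_cst.
apply: (intble_dom _ (intbleD (intble_cst P 1) i2)) => [|w].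
  by under eq_fun do rewrite expr1.
rewrite expr1 -(@real_normK _ (xi i w))// ?num_real//.
by have := sqr_ge0 (`|xi i w| - 1); nra.
Qed.

Lemma cond_momentP k i : (1 <= i <= n)%N ->
  is_cond_exp P (F i.-1) (fun w => xi i w ^+ k) (cond_moment P F xi k i).
Proof. by move=> i1n; apply: cond_expP; [exact: sub_pred|exact: intble_xiX]. Qed.

Let E_cond_moment k i (c : R) (W : T -> R) : (1 <= i <= n)%N ->
  measurable_wrt (F i.-1) W -> (forall w, `|W w| <= c) ->
  [/\ intble (fun w => W w * xi i w ^+ k), intble (fun w => W w * cond_moment P F xi k i w) &
  E (fun w => W w * xi i w ^+ k) = E (fun w => W w * cond_moment P F xi k i w)].
Proof.
move=> i1n mW Wc; have sG := sub_pred i1n; have mWT := measurable_wrtW sG mW.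
have H := cond_momentP k i1n; have [_ iY _] := H.
have i1 := intble_bddM mWT Wc (intble_xiX k i1n); have i2 := intble_bddM mWT Wc iY.
by split => //; exact: (E_cond_exp sG (intble_xiX k i1n) H).
Qed.

Lemma cond_var_ge0 i : (1 <= i <= n)%N ->
  {ae P, forall w, 0 <= cond_moment P F xi 2 i w}.
Proof.
move=> i1n; have [mY iY _] := cond_momentP 2 i1n.
apply: (ae_ge0_of_weighted_E (sub_pred i1n) mY iY) => W mW W01.
have Wc w : `|W w| <= 1 by have /andP[? ?] := W01 w; rewrite ger0_norm.
have [_ _ <-] := E_cond_moment 2 i1n mW Wc.
apply: Rintegral_ge0 => w _; have /andP[? _] := W01 w.
by rewrite mulr_ge0// sqr_ge0.
Qed.

Lemma cond_moment4_le i : (1 <= i <= n)%N ->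
  {ae P, forall w, cond_moment P F xi 4 i w <= 12 * e ^+ 2 * cond_moment P F xi 2 i w}.
Proof.
move=> i1n; have [_] := bc (isT : (3 <= 4)%N) i1n.
apply: filterS => w; rewrite ler_norml => /andP[_] /le_trans; apply.
rewrite (_ : (4`!)%:R = 24 :> R)//.
by rewrite (_ : 2^-1 * 24 = 12 :> R)//; field.
Qed.

Lemma cond_moment6_le i : (1 <= i <= n)%N ->
  {ae P, forall w, cond_moment P F xi 6 i w <= 360 * e ^+ 4 * cond_moment P F xi 2 i w}.
Proof.
move=> i1n; have [_] := bc (isT : (3 <= 6)%N) i1n.
apply: filterS => w; rewrite ler_norml => /andP[_] /le_trans; apply.
rewrite (_ : (6`!)%:R = 720 :> R)//.
by rewrite (_ : 2^-1 * 720 = 360 :> R)//; field.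
Qed.

(** From [0 <= (x ^ 2 - c) ^ 2] one gets [2 c v - c ^ 2 <= E (x ^ 4 | F)],
which is at most [c v] for [c = 12 e ^ 2]; hence [v <= c]. *)
Lemma cond_var_le i : (1 <= i <= n)%N ->
  {ae P, forall w, cond_moment P F xi 2 i w <= 12 * e ^+ 2}.
Proof.
move=> i1n; pose c := 12 * e ^+ 2.
have c0 : 0 < c by rewrite /c mulr_gt0// exprn_gt0.
have [m2 i2 _] := cond_momentP 2 i1n; have [m4 i4 _] := cond_momentP 4 i1n.
pose U w := cond_moment P F xi 4 i w - 2 * c * cond_moment P F xi 2 i w + c ^+ 2.
have : {ae P, forall w, 0 <= U w}.
  apply: (ae_ge0_of_weighted_E (sub_pred i1n)).
  - apply: measurable_funD => //; apply: measurable_funB => //.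
    exact: measurable_funM.
  - by apply: intbleD; [apply: intbleB => //; exact: intbleZ|exact: intble_cst].
  move=> W mW W01.
  have Wc w : `|W w| <= 1 by have /andP[? ?] := W01 w; rewrite ger0_norm.
  have mWT := measurable_wrtW (sub_pred i1n) mW.
  have [a2 b2 e2] := E_cond_moment 2 i1n mW Wc.
  have [a4 b4 e4] := E_cond_moment 4 i1n mW Wc.
  have iW := intble_bddM mWT Wc (intble_cst P (c ^+ 2)).
  have -> : E (fun w => W w * U w) =
    E (fun w => W w * cond_moment P F xi 4 i w - 2 * c * (W w * cond_moment P F xi 2 i w)
        + W w * c ^+ 2).
    by apply: eq_Rintegral => w _; rewrite /U; ring.
  rewrite ED//; last by apply: intbleB => //; exact: intbleZ.
  rewrite EB//; last exact: intbleZ.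
  rewrite EZ// -e2 -e4 -EZ// -EB//; last exact: intbleZ.
  rewrite -ED//; last by apply: intbleB => //; exact: intbleZ.
  apply: Rintegral_ge0 => w _; have /andP[W0 _] := W01 w.
  have -> : W w * xi i w ^+ 4 - 2 * c * (W w * xi i w ^+ 2) + W w * c ^+ 2 =
    W w * (xi i w ^+ 2 - c) ^+ 2 by ring.
  by rewrite mulr_ge0// sqr_ge0.
apply: filterS2 (cond_moment4_le i1n) => w h4 hU.
rewrite -/c -(ler_pM2l c0); move: h4 hU; rewrite -/c /U.
by move: (cond_moment P F xi 4 i w) (cond_moment P F xi 2 i w) => p q; rewrite expr2; lra.
Qed.

(** Clipping makes the bounds [0] and [12 e ^ 2] hold everywhere instead of
almost surely, so that the weights built from these variances are bounded. *)
Definition cvar i w := Num.min (12 * e ^+ 2) (Num.max 0 (cond_moment P F xi 2 i w)).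

Lemma cvar_ge0 i w : 0 <= cvar i w.
Proof. by rewrite le_min le_max lexx mulr_ge0// sqr_ge0. Qed.

Lemma cvar_le i w : cvar i w <= 12 * e ^+ 2.
Proof. by rewrite ge_min lexx. Qed.

Lemma measurable_cvar i : (1 <= i <= n)%N -> measurable_wrt (F i.-1) (cvar i).
Proof.
move=> i1n; have [m2 _ _] := cond_momentP 2 i1n.
by apply: measurable_minr => //; exact: measurable_maxr.
Qed.

Lemma cvar_ae i : (1 <= i <= n)%N ->
  {ae P, forall w, cvar i w = cond_moment P F xi 2 i w}.
Proof.
move=> i1n; apply: filterS2 (cond_var_ge0 i1n) (cond_var_le i1n) => w h0 h1.
by rewrite /cvar max_r// min_r.
Qed.

Lemma intble_cvar i : (1 <= i <= n)%N -> intble (cvar i).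
Proof.
move=> i1n; apply: (@intble_bdd _ _ _ P (12 * e ^+ 2)).
  exact: (measurable_wrtW (sub_pred i1n) (measurable_cvar i1n)).
by move=> w; rewrite ger0_norm ?cvar_ge0 ?cvar_le.
Qed.

Lemma E_xi i (W : T -> R) : (1 <= i <= n)%N -> measurable_wrt (F i.-1) W ->
  intble (fun w => W w * xi i w) -> E (fun w => W w * xi i w) = 0.
Proof.
move=> i1n mW iW; have sG := sub_pred i1n.
have ix : intble (xi i).
  by have := intble_xiX 1 i1n; under eq_fun do rewrite expr1.
have H0 : is_cond_exp P (F i.-1) (xi i) (fun=> 0).
  apply: (is_cond_exp_ae_eq sG (cond_expP sG ix)).
  - exact: measurable_cst.
  - exact: (intble_cst P 0).
  by apply: filterS (md_centered md i1n) => w ->.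
have i0 : intble (fun w => W w * 0) by under eq_fun do rewrite mulr0; exact: intble_cst.
rewrite (E_cond_exp sG ix H0 mW iW i0).
by under eq_Rintegral do rewrite mulr0; exact: Ecst.
Qed.

Lemma E_xi2 i (c : R) (W : T -> R) : (1 <= i <= n)%N ->
  measurable_wrt (F i.-1) W -> (forall w, `|W w| <= c) ->
  E (fun w => W w * xi i w ^+ 2) = E (fun w => W w * cvar i w).
Proof.
move=> i1n mW Wc; have [_ iW ->] := E_cond_moment 2 i1n mW Wc.
have mWT := measurable_wrtW (sub_pred i1n) mW.
apply: ae_eq_E => //; first exact: (intble_bddM mWT Wc (intble_cvar i1n)).
by apply: filterS (cvar_ae i1n) => w ->.
Qed.

Let E_xi_even k (K : R) i (c : R) (W : T -> R) : (1 <= i <= n)%N ->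
  {ae P, forall w, cond_moment P F xi k i w <= K * cond_moment P F xi 2 i w} ->
  measurable_wrt (F i.-1) W -> (forall w, 0 <= W w <= c) ->
  E (fun w => W w * xi i w ^+ k) <= K * E (fun w => W w * cvar i w).
Proof.
move=> i1n kK mW W0c.
have Wc w : `|W w| <= c by have /andP[? ?] := W0c w; rewrite ger0_norm.
have mWT := measurable_wrtW (sub_pred i1n) mW.
have iWv := intble_bddM mWT Wc (intble_cvar i1n).
have [_ iW ->] := E_cond_moment k i1n mW Wc.
rewrite -EZ//; apply: ae_le_E => //; first exact: intbleZ.
apply: filterS2 kK (cvar_ae i1n) => w h ->; have /andP[W0 _] := W0c w.
by rewrite mulrCA ler_wpM2l.
Qed.

Lemma E_xi4 i (c : R) (W : T -> R) : (1 <= i <= n)%N ->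
  measurable_wrt (F i.-1) W -> (forall w, 0 <= W w <= c) ->
  E (fun w => W w * xi i w ^+ 4) <= 12 * e ^+ 2 * E (fun w => W w * cvar i w).
Proof. by move=> i1n; exact/E_xi_even/cond_moment4_le. Qed.

Lemma E_xi6 i (c : R) (W : T -> R) : (1 <= i <= n)%N ->
  measurable_wrt (F i.-1) W -> (forall w, 0 <= W w <= c) ->
  E (fun w => W w * xi i w ^+ 6) <= 360 * e ^+ 4 * E (fun w => W w * cvar i w).
Proof. by move=> i1n; exact/E_xi_even/cond_moment6_le. Qed.

Lemma sum_cvar (delta : R) : quad_char_condition P n F xi delta ->
  {ae P, forall w, `|\sum_(1 <= i < n.+1) cvar i w - 1| <= delta ^+ 2}.
Proof.
move=> qc.
have : {ae P, forall w, forall i, (1 <= i <= n)%N -> cvar i w = cond_moment P F xi 2 i w}.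
  apply/ae_foralln => i; have [i1n|i1n] := boolP (1 <= i <= n)%N.
    by apply: filterS (cvar_ae i1n) => w.
  exact: aeW.
apply: filterS2 qc => w qw cw; move: qw; rewrite /quad_char.
by congr (`|_ - _| <= _); apply: eq_big_nat => i i1n; rewrite cw.
Qed.

(** * Lindeberg's replacement *)

Variable delta : R.
Hypothesis qc : quad_char_condition P n F xi delta.

Let cvar_sum_le : {ae P, forall w, \sum_(1 <= i < n.+1) cvar i w <= 1 + delta ^+ 2}.
Proof.
by apply: filterS (sum_cvar qc) => w; rewrite ler_norml => /andP[_]; rewrite lerBlDl.
Qed.

Let adapted_xi i : (1 <= i <= n)%N -> measurable_wrt (F i) (xi i).
Proof. by move=> /andP[_ i_n]; exact: (md_adapted md i_n). Qed.

#[local] Hint Resolve cvar_ge0 cvar_le : core.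

Section lindeberg.
Variable b : R.
Hypothesis eb : 4 * e <= b.

Definition partial_sum k w := \sum_(1 <= i < k.+1) xi i w.

(** The standard deviation of the Gaussian smoothing at time [k]. *)
Definition scale k w :=
  Num.sqrt (b ^+ 2 + Num.max 0 (1 + delta ^+ 2 - \sum_(1 <= i < k.+1) cvar i w)).

Let b_gt0 : 0 < b. Proof. by have := e_gt0; have := eb; lra. Qed.

Let e_leb : e <= b. Proof. by have := e_gt0; have := eb; lra. Qed.

Let cvar_leb i w : cvar i w <= b ^+ 2.
Proof.
apply: (le_trans (cvar_le i w)).
have : (4 * e) ^+ 2 <= b ^+ 2.
  by apply: lerXn2r; rewrite ?nnegrE; have := eb; have := e_gt0; lra.
by rewrite exprMn; have := sqr_ge0 e; nra.
Qed.

Lemma scale_geb k w : b <= scale k w.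
Proof.
rewrite -[leLHS]ger0_norm ?(ltW b_gt0)// -sqrtr_sqr ler_wsqrtr// lerDl.
by rewrite le_max lexx.
Qed.

Lemma scale_gt0 k w : 0 < scale k w.
Proof. exact: lt_le_trans b_gt0 (scale_geb k w). Qed.

Lemma scale_sqr k w : scale k w ^+ 2 =
  b ^+ 2 + Num.max 0 (1 + delta ^+ 2 - \sum_(1 <= i < k.+1) cvar i w).
Proof. by rewrite sqr_sqrtr// addr_ge0 ?sqr_ge0// le_max lexx. Qed.

Lemma cvar_le_scale i k w : cvar i w <= scale k w ^+ 2.
Proof.
by apply: (le_trans (cvar_leb i w)); rewrite scale_sqr lerDl le_max lexx.
Qed.

(** The positive part in [scale] is almost surely inactive, since the sum of
all conditional variances is at most [1 + delta ^ 2]. *)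
Lemma scale_rec : {ae P, forall w, forall k, (1 <= k <= n)%N ->
  scale k.-1 w = Num.sqrt (scale k w ^+ 2 + cvar k w)}.
Proof.
apply: filterS cvar_sum_le => w Qw [//|k] /= kn; rewrite scale_sqr {1}/scale; congr Num.sqrt.
have Qk j : (j <= n)%N -> \sum_(1 <= i < j.+1) cvar i w <= 1 + delta ^+ 2.
  move=> jn; apply: le_trans Qw.
  by rewrite [leRHS](@big_cat_nat _ _ _ j.+1)//= lerDl sumr_ge0.
rewrite !max_r ?subr_ge0 ?Qk// ?(ltnW kn)//.
by rewrite [in RHS]big_nat_recr//=; ring.
Qed.

Lemma partial_sum_rec k w : (1 <= k)%N -> partial_sum k w = partial_sum k.-1 w + xi k w.
Proof. by case: k => // k _; rewrite /partial_sum big_nat_recr. Qed.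

Lemma measurable_partial_sum k : (k <= n)%N -> measurable_wrt (F k) (partial_sum k).
Proof.
move=> kn; rewrite /partial_sum /measurable_wrt.
have -> : (fun w => \sum_(1 <= i < k.+1) xi i w) =
   fun w => \sum_(i < k) xi i.+1 w.
  by apply/funext => w; rewrite big_add1/= big_mkord.
apply: (@measurable_sum _ (g_sigma_algebraType (F k)) R setT 'I_k) => i.
have ik : (1 <= i.+1 <= n)%N by rewrite /= (leq_trans (ltn_ord i)).
apply: (measurable_wrt_le _ (adapted_xi ik)); apply: filtration_le.
by rewrite ltn_ord.
Qed.

Lemma measurable_cvar_sum k : (1 <= k <= n)%N ->
  measurable_wrt (F k.-1) (fun w => \sum_(1 <= i < k.+1) cvar i w).
Proof.
move=> /andP[k1 kn].
have -> : (fun w => \sum_(1 <= i < k.+1) cvar i w) =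
   fun w => \sum_(i < k) cvar i.+1 w.
  by apply/funext => w; rewrite big_add1/= big_mkord.
apply: (@measurable_sum _ (g_sigma_algebraType (F k.-1)) R setT 'I_k) => i.
have ik : (1 <= i.+1 <= n)%N by rewrite /= (leq_trans (ltn_ord i)).
apply: (measurable_wrt_le _ (measurable_cvar ik)); apply: filtration_le.
by case: k k1 kn i ik => // k _ kn i _ /=; rewrite -ltnS ltn_ord ltnW.
Qed.

Lemma measurable_scale k : (1 <= k <= n)%N -> measurable_wrt (F k.-1) (scale k).
Proof.
move=> kn; apply: measurable_fun_sqrt => [w|].
  by rewrite addr_ge0 ?sqr_ge0// le_max lexx.
apply: measurable_funD => //; apply: measurable_maxr => //.
by apply: measurable_funB => //; exact: measurable_cvar_sum.
Qed.

Lemma measurable_wrtT k (f : T -> R) : (k <= n)%N ->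
  measurable_wrt (F k) f -> measurable_fun [set: T] f.
Proof. by move=> kn; exact: (measurable_wrtW (md_sigma md kn)). Qed.

Lemma measurable_scaleT k : (k <= n)%N -> measurable_fun [set: T] (scale k).
Proof.
case: k => [_|k kn]; last first.
  by apply: (@measurable_wrtT k _ (ltnW kn)); exact: (@measurable_scale k.+1).
rewrite /scale; under eq_fun do rewrite big_geq//.
exact: measurable_cst.
Qed.

Lemma measurable_partial_sumT k : (k <= n)%N -> measurable_fun [set: T] (partial_sum k).
Proof. by move=> kn; apply: (measurable_wrtT kn); exact: measurable_partial_sum. Qed.

Definition weight k u w := cauchy_weight (scale k w) (u - partial_sum k.-1 w).

Let step_regroup (p q c1 c2 x r : R) :
  p - q + c1 * x + c2 * (x ^+ 2 - r) = (p - q) + (c1 * x + (c2 * x ^+ 2 - c2 * r)).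
Proof. by ring. Qed.

Section step.
Variables (k : nat) (u : R).
Hypothesis kn : (1 <= k <= n)%N.

Let k1 : (1 <= k)%N. Proof. by case/andP: kn. Qed.

Let k1n : (k.-1 <= n)%N.
Proof. by case/andP: kn => _; apply: leq_trans; exact: leq_pred. Qed.

Let y w := u - partial_sum k.-1 w.

Let y_rec w : u - partial_sum k w = y w - xi k w.
Proof. by rewrite /y (partial_sum_rec w k1) opprD addrA. Qed.

Let my : measurable_wrt (F k.-1) y.
Proof. by apply: measurable_funB => //; exact: measurable_partial_sum. Qed.

Let mS := measurable_scale kn.

Let mz : measurable_wrt (F k.-1) (fun w => y w / scale k w).
Proof.
apply: measurable_funM => //; apply: measurable_fun_inv => // w.
exact/ltW/scale_gt0.
Qed.

Let mphi : measurable_wrt (F k.-1) (fun w => phi (y w / scale k w)).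
Proof.
apply: (measurableT_comp (f := @phi R)) => //.
exact: (continuous_measurable_fun (@continuous_phi R)).
Qed.

Lemma measurable_weight : measurable_wrt (F k.-1) (weight k u).
Proof. by apply: measurable_cauchy_weight => // w; exact: scale_gt0. Qed.

Lemma weight_bound w : 0 <= weight k u w <= (b ^+ 3)^-1.
Proof. by rewrite cauchy_weight_ge0 ?(ltW (scale_gt0 _ _))//= cauchy_weight_le// scale_geb. Qed.

Let norm_weight w : `|weight k u w| <= (b ^+ 3)^-1.
Proof. by have /andP[? ?] := weight_bound w; rewrite ger0_norm. Qed.

Let mWT := measurable_wrtT k1n measurable_weight.

(** The two compensating terms, with coefficients [W1] and [W2], have
expectation zero, so they can be added before taking absolute values. *)
Lemma lindeberg_increment (C B : R) : 0 <= C -> B = 385 * C ->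
  expansion_constant C ->
  `|E (fun w => Phi ((u - partial_sum k w) / scale k w)) -
    E (fun w => Phi ((u - partial_sum k.-1 w) / scale k.-1 w))| <=
  B * e * E (fun w => cvar k w * weight k u w).
Proof.
move=> C0 CB HC.
have [C1 C10 H1] := phi_derivatives_decay R.
pose W1 w := phi (y w / scale k w) / scale k w.
pose W2 w := y w / scale k w * phi (y w / scale k w) / (2 * scale k w ^+ 2).
have mSi : measurable_wrt (F k.-1) (fun w => (scale k w)^-1).
  by apply: measurable_fun_inv => // w; exact/ltW/scale_gt0.
have mW1 : measurable_wrt (F k.-1) W1 by exact: measurable_funM.
have mW2 : measurable_wrt (F k.-1) W2.
  apply: measurable_funM; first exact: measurable_funM.
  apply: measurable_fun_inv => [w|]; first by rewrite mulr_ge0// sqr_ge0.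
  by apply: measurable_funM => //; exact: measurable_funX.
have bW1 w : `|W1 w| <= b^-1.
  rewrite /W1 normrM ger0_norm ?phi_ge0// normfV (gtr0_norm (scale_gt0 _ _)).
  rewrite -[leRHS]mul1r ler_pM ?phi_ge0 ?phi_le1 ?invr_ge0 ?(ltW (scale_gt0 _ _))//.
  by rewrite lef_pV2 ?posrE ?scale_gt0// scale_geb.
have bW2 w : `|W2 w| <= C1 * (b ^+ 2)^-1.
  rewrite /W2 normrM; apply: ler_pM => //.
    rewrite normrM [`|phi _|]ger0_norm ?phi_ge0//.
    have [h _] := H1 (y w / scale k w); apply: (le_trans h).
    rewrite ler_piMr// invf_le1; last by rewrite exprn_gt0//; have := sqr_ge0 (y w / scale k w); lra.
    by rewrite exprn_ege1// lerDl sqr_ge0.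
  have b2S : b ^+ 2 <= scale k w ^+ 2 by rewrite lerXn2r ?nnegrE ?scale_geb ?(ltW b_gt0)// ltW// scale_gt0.
  have b20 : 0 < b ^+ 2 by rewrite exprn_gt0.
  rewrite ger0_norm ?invr_ge0; last by lra.
  by rewrite lef_pV2 ?posrE; lra.
have i1 := intble_xiX 1 kn; have i2 := intble_xiX 2 kn.
have i4 := intble_xiX 4 kn; have i6 := intble_xiX 6 kn.
have iv := intble_cvar kn.
have mW1T := measurable_wrtT k1n mW1; have mW2T := measurable_wrtT k1n mW2.
have iW1 : intble (fun w => W1 w * xi k w).
  exact: (intble_bddM mW1T bW1 (i1 : intble (xi k))).
have iW2 := intble_bddM mW2T bW2 i2.
have iW2v := intble_bddM mW2T bW2 iv.
have kn' : (k <= n)%N by case/andP: kn.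
have iPk := intble_PhiS P (measurable_partial_sumT kn') (measurable_scaleT kn') (scale_gt0 k) u.
have iPk1 := intble_PhiS P (measurable_partial_sumT k1n) (measurable_scaleT k1n) (scale_gt0 k.-1) u.
pose f w := (Phi ((u - partial_sum k w) / scale k w) -
    Phi ((u - partial_sum k.-1 w) / scale k.-1 w))
  + (W1 w * xi k w + (W2 w * xi k w ^+ 2 - W2 w * cvar k w)).
have iA := intbleB iPk iPk1.
have iB := intbleB iW2 iW2v.
have iAB := intbleD iW1 iB.
have fi : intble f by exact: intbleD.
have fE : E f = E (fun w => Phi ((u - partial_sum k w) / scale k w)) -
    E (fun w => Phi ((u - partial_sum k.-1 w) / scale k.-1 w)).
  rewrite /f ED// EB// ED// EB// (E_xi2 kn mW2 bW2) subrr addr0.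
  by rewrite (E_xi kn mW1)// addr0.
have j2 := intble_bddM mWT norm_weight i2; have j4 := intble_bddM mWT norm_weight i4.
have j6 := intble_bddM mWT norm_weight i6; have jv := intble_bddM mWT norm_weight iv.
pose g w := C * (e * (weight k u w * xi k w ^+ 2) + e^-1 * (weight k u w * xi k w ^+ 4) +
  (e ^+ 3)^-1 * (weight k u w * xi k w ^+ 6) + 12 * e * (weight k u w * cvar k w)).
have g4 := intbleD (intbleD (intbleD (intbleZ e j2) (intbleZ e^-1 j4))
  (intbleZ (e ^+ 3)^-1 j6)) (intbleZ (12 * e) jv).
have gi : intble g by exact: intbleZ.
have fg : {ae P, forall w, `|f w| <= g w}.
  apply: filterS scale_rec => w /(_ k kn) Sw.
  have -> : g w = C * (e * xi k w ^+ 2 + xi k w ^+ 4 / e + xi k w ^+ 6 / e ^+ 3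
      + 12 * e * cvar k w) * cauchy_weight (scale k w) (y w).
    by rewrite /g /weight -/(y w); ring.
  have es : e <= scale k w := le_trans e_leb (scale_geb k w).
  have := HC e (y w) (scale k w) (cvar k w) (xi k w) e_gt0 es
    (cvar_ge0 _ _) (cvar_le _ _) (cvar_le_scale k k w).
  apply: le_trans; rewrite -Sw.
  rewrite -(y_rec w).
  rewrite /f; have <- := step_regroup (Phi ((u - partial_sum k w) / scale k w))
    (Phi ((u - partial_sum k.-1 w) / scale k.-1 w)) (W1 w) (W2 w) (xi k w) (cvar k w).
  exact: lexx.
rewrite -fE.
have : `|E f| <= E g.
  rewrite ler_norml; apply/andP; split; last first.
    by apply: ae_le_E => //; apply: filterS fg => w; rewrite ler_norml => /andP[].
  rewrite lerNl -mulN1r -EZ//; apply: ae_le_E => //; first exact: intbleZ.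
  by apply: filterS fg => w; rewrite ler_norml mulN1r => /andP[]; rewrite lerNl.
move=> /le_trans; apply.
rewrite /g EZ// ED// ?ED// ?EZ//; try by repeat (apply: intbleD || apply: intbleZ).
have t4 := E_xi4 kn measurable_weight weight_bound.
have t6 := E_xi6 kn measurable_weight weight_bound.
rewrite (E_xi2 kn measurable_weight norm_weight).
have -> : E (fun w => cvar k w * weight k u w) = E (fun w => weight k u w * cvar k w).
  by apply: eq_Rintegral => w _; rewrite mulrC.
exact: (moment_sum_le C0 CB e_gt0 t4 t6).
Qed.

End step.

Lemma intble_tail_sum (k m : nat) : (k <= m <= n)%N ->
  intble (fun w => \sum_(k.+1 <= i < m.+1) cvar i w).
Proof.
move=> /andP[km mn]; elim: m km mn => [|m IH] km mn.
  by under eq_fun do rewrite big_geq//; exact: intble_cst.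
have [mk|km'] := leqP m.+1 k.
  by under eq_fun do rewrite big_geq//; exact: intble_cst.
under eq_fun do rewrite big_nat_recr//=.
by apply: intbleD; [exact: (IH _ (ltnW mn))|exact: intble_cvar].
Qed.

(** Orthogonality of the increments, weighted by a function of the past. *)
Lemma tail_second_moment (k m : nat) (c : R) (W : T -> R) :
  (k <= m <= n)%N -> measurable_wrt (F k) W -> (forall w, `|W w| <= c) ->
  intble (fun w => (partial_sum m w - partial_sum k w) ^+ 2) /\
  E (fun w => W w * (partial_sum m w - partial_sum k w) ^+ 2) =
  E (fun w => W w * \sum_(k.+1 <= i < m.+1) cvar i w).
Proof.
move=> /andP[km mn] mW Wc.
elim: m km mn => [|m IH].
  rewrite leqn0 => /eqP k0 _; rewrite k0; split.
    by under eq_fun do rewrite subrr expr0n/=; exact: intble_cst.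
  by apply: eq_Rintegral => w _; rewrite subrr expr0n/= big_geq.
rewrite leq_eqVlt => /predU1P[-> _|].
  split; first by under eq_fun do rewrite subrr expr0n/=; exact: intble_cst.
  by apply: eq_Rintegral => w _; rewrite subrr expr0n/= big_geq.
rewrite ltnS => km mn; have {IH} [iH EH] := IH km (ltnW mn).
have kn : (k <= n)%N := leq_trans km (ltnW mn).
have mWT := measurable_wrtT kn mW.
pose H w := partial_sum m w - partial_sum k w; pose x := xi m.+1.
have m1n : (1 <= m.+1 <= n)%N by [].
have mH : measurable_wrt (F m) H.
  apply: measurable_funB; first exact: (measurable_partial_sum (ltnW mn)).
  apply: (measurable_wrt_le _ (measurable_partial_sum kn)); apply: filtration_le.
  by rewrite km ltnW.
have mHT := measurable_wrtT (ltnW mn) mH.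
have ix := intble_xiX 1 m1n; have ixx := intble_xiX 2 m1n.
have mxT := intble_meas ix.
have iHx : intble (fun w => H w * x w).
  apply: (intble_dom _ (intbleD iH ixx)); first exact: measurable_funM.
  by move=> w; exact: norm_mul_le.
have HE w : (partial_sum m.+1 w - partial_sum k w) ^+ 2 = H w ^+ 2 + 2 * (H w * x w) + x w ^+ 2.
  by rewrite (@partial_sum_rec m.+1 w isT) /= /H /x; ring.
have i2Hx := intbleZ 2 iHx.
split; first by under eq_fun do rewrite HE; apply: intbleD => //; exact: intbleD.
under eq_Rintegral do rewrite HE.
have j1 := intble_bddM mWT Wc iH.
have j2 := intble_bddM mWT Wc iHx.
have j3 := intble_bddM mWT Wc ixx.
have jv := intble_bddM mWT Wc (intble_cvar m1n).
have mWF : measurable_wrt (F m) W.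
  by apply: (measurable_wrt_le _ mW); apply: filtration_le; rewrite km ltnW.
have e2 : E (fun w => W w * (H w * x w)) = 0.
  under eq_Rintegral do rewrite mulrA.
  apply: (E_xi m1n); first exact: measurable_funM.
  by under eq_fun do rewrite -mulrA.
have e3 : E (fun w => W w * x w ^+ 2) = E (fun w => W w * cvar m.+1 w).
  by apply: (E_xi2 m1n _ Wc).
have -> : E (fun w => W w * (H w ^+ 2 + 2 * (H w * x w) + x w ^+ 2)) =
   E (fun w => W w * H w ^+ 2 + 2 * (W w * (H w * x w)) + W w * x w ^+ 2).
  by apply: eq_Rintegral => w _; ring.
rewrite ED//; last by apply: intbleD => //; exact: intbleZ.
rewrite ED//; last exact: intbleZ.
rewrite EZ// e2 e3 mulr0 addr0 EH -ED//.
  by apply: eq_Rintegral => w _; rewrite [in RHS]big_nat_recr//= mulrDr.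
apply: (intble_bddM mWT Wc).
by apply: intble_tail_sum; rewrite km ltnW.
Qed.

Lemma tail_sum_le : {ae P, forall w, forall k, (1 <= k <= n)%N ->
  \sum_(k.-1.+1 <= i < n.+1) cvar i w <= 2 * scale k w ^+ 2}.
Proof.
apply: filterS cvar_sum_le => w Qw [//|k] /= kn.
rewrite big_ltn ?ltnS//.
have -> : 2 * scale k.+1 w ^+ 2 = scale k.+1 w ^+ 2 + scale k.+1 w ^+ 2 by ring.
apply: lerD; first exact: cvar_le_scale.
rewrite scale_sqr; apply: ler_wpDl; first exact: sqr_ge0.
rewrite le_max; apply/orP; right; rewrite lerBrDl; apply: le_trans Qw.
by rewrite [leRHS](@big_cat_nat _ _ _ k.+2)//= ltnS ltnW.
Qed.

(** By [cauchy_weight_shift] it suffices that the increment from [k - 1] to [n]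
have weighted second moment at most [2 * scale k ^ 2]: this is
[tail_second_moment] with [tail_sum_le], because the variance still to come
is part of the scale. *)
Lemma weight_at_end (k : nat) (u : R) : (1 <= k <= n)%N ->
  E (fun w => cvar k w * weight k u w) <=
  6 * E (fun w => cvar k w * cauchy_weight (scale k w) (u - partial_sum n w)).
Proof.
move=> kn; have kn' : (k <= n)%N by case/andP: kn.
have k1n : (k.-1 <= n)%N := leq_trans (leq_pred _) kn'.
pose U w := cvar k w * weight k u w.
pose U' w := cvar k w * cauchy_weight (scale k w) (u - partial_sum n w).
pose W w := U w / scale k w ^+ 2.
have k_ge0 w y : 0 <= cauchy_weight (scale k w) y by rewrite cauchy_weight_ge0// ltW// scale_gt0.
have k_le w y : cauchy_weight (scale k w) y <= (b ^+ 3)^-1 by rewrite cauchy_weight_le// scale_geb.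
have mU : measurable_wrt (F k.-1) U.
  by apply: measurable_funM; [exact: measurable_cvar|exact: measurable_weight].
have mUT := measurable_wrtT k1n mU.
have vk_bound w y : `|cvar k w * cauchy_weight (scale k w) y| <= 12 * e ^+ 2 * (b ^+ 3)^-1.
  by rewrite ger0_norm ?mulr_ge0// ler_pM.
have mU' : measurable_fun [set: T] U'.
  apply: measurable_funM; first exact: (measurable_wrtT k1n (measurable_cvar kn)).
  apply: measurable_cauchy_weight; [exact: scale_gt0|exact: measurable_scaleT|].
  by apply: measurable_funB => //; exact: measurable_partial_sumT.
have iU : intble U by exact: (intble_bdd P mUT (fun w => vk_bound w (u - partial_sum k.-1 w))).
have iU' : intble U' by exact: (intble_bdd P mU' (fun w => vk_bound w (u - partial_sum n w))).
have S2_gt0 w : 0 < scale k w ^+ 2 by rewrite exprn_gt0// scale_gt0.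
have mW : measurable_wrt (F k.-1) W.
  apply: measurable_funM => //; apply: measurable_fun_inv => [w|]; first exact: ltW.
  by apply: measurable_funX; exact: measurable_scale.
have Wb w : `|W w| <= 12 * e ^+ 2 * (b ^+ 3)^-1 * (b ^+ 2)^-1.
  rewrite /W normrM; apply: ler_pM => //; first exact: vk_bound.
  rewrite ger0_norm ?invr_ge0 ?(ltW (S2_gt0 w))//.
  rewrite lef_pV2 ?posrE ?exprn_gt0 ?scale_gt0//.
  by rewrite lerXn2r ?nnegrE ?scale_geb ?(ltW b_gt0)// ltW// scale_gt0.
have kn1 : (k.-1 <= n <= n)%N by rewrite k1n leqnn.
have [iH EH] := tail_second_moment kn1 mW Wb.
have mWT := measurable_wrtT k1n mW.
have iWH := intble_bddM mWT Wb iH.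
have iWs := intble_bddM mWT Wb (intble_tail_sum kn1).
have h1 : E (fun w => W w * \sum_(k.-1.+1 <= i < n.+1) cvar i w) <= 2 * E U.
  rewrite -EZ//; apply: ae_le_E => //; first exact: intbleZ.
  apply: filterS tail_sum_le => w /(_ k kn) sw.
  have -> : 2 * U w = W w * (2 * scale k w ^+ 2).
    by rewrite /W; field; rewrite gt_eqF// scale_gt0.
  rewrite ler_wpM2l// /W divr_ge0 ?(ltW (S2_gt0 w))// mulr_ge0//.
  by case/andP: (weight_bound k u w).
have h2 : E (fun w => 5 * U w - W w * (partial_sum n w - partial_sum k.-1 w) ^+ 2) <=
   E (fun w => 18 * U' w).
  apply: le_E => [||w]; [by apply: intbleB => //; exact: intbleZ|exact: intbleZ|].
  have := cauchy_weight_shift (u - partial_sum k.-1 w) (u - partial_sum n w)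
    (scale_gt0 k w) (cvar_ge0 k w).
  by have -> : u - partial_sum k.-1 w - (u - partial_sum n w) =
    partial_sum n w - partial_sum k.-1 w by ring.
move: h2; rewrite EB//; last exact: intbleZ.
rewrite !EZ// EH -/U -/U'.
by move: h1; move: (E U) (E U') (E _) => p q r; lra.
Qed.

Lemma lindeberg_total (C B u : R) : 0 <= C -> B = 385 * C ->
  expansion_constant C ->
  `|E (fun w => Phi ((u - partial_sum n w) / scale n w)) -
    Phi (u / Num.sqrt (b ^+ 2 + (1 + delta ^+ 2)))| <=
  B * e * (72 * E (fun w => (b + `|u - partial_sum n w|)^-1)).
Proof.
move=> C0 CB HC.
have B0 : 0 <= B by rewrite CB; exact: (mulr_ge0 (ler0n _ _) C0).
pose a k := E (fun w => Phi ((u - partial_sum k w) / scale k w)).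
have a0 : a 0%N = Phi (u / Num.sqrt (b ^+ 2 + (1 + delta ^+ 2))).
  rewrite /a -[RHS](Ecst P); apply: eq_Rintegral => w _.
  rewrite /partial_sum /scale !big_geq// !subr0 max_r//.
  by rewrite addr_ge0 ?sqr_ge0.
rewrite -a0 -/(a n) -(telescope_sumr _ (leq0n n)) big_mkord.
apply: le_trans (ler_norm_sum _ _ _) _.
pose V (k : 'I_n) w := cvar k.+1 w * cauchy_weight (scale k.+1 w) (u - partial_sum n w).
have kn (k : 'I_n) : (1 <= k.+1 <= n)%N by rewrite /= ltn_ord.
have iV k : intble (V k).
  have mV : measurable_fun [set: T] (V k).
    have k1n : (k.+1.-1 <= n)%N := ltnW (ltn_ord k).
    apply: measurable_funM; first exact: (measurable_wrtT k1n (measurable_cvar (kn k))).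
    apply: measurable_cauchy_weight; [exact: scale_gt0|exact: measurable_scaleT|].
    by apply: measurable_funB => //; exact: measurable_partial_sumT.
  apply: (@intble_bdd _ _ _ P (12 * e ^+ 2 * (b ^+ 3)^-1)) => // w.
  have k_ge0 : 0 <= cauchy_weight (scale k.+1 w) (u - partial_sum n w).
    by rewrite cauchy_weight_ge0// ltW// scale_gt0.
  by rewrite ger0_norm ?mulr_ge0// ler_pM// cauchy_weight_le// scale_geb.
have Ce0 : 0 <= B * e.
  by rewrite mulr_ge0// ltW.
apply: (@le_trans _ _ (\sum_(k < n) B * e * (6 * E (V k)))).
  apply: ler_sum => k _; apply: (le_trans (lindeberg_increment u (kn k) C0 CB HC)).
  exact: (ler_wpM2l Ce0 (weight_at_end u (kn k))).
rewrite -mulr_sumr; apply: (ler_wpM2l Ce0).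
rewrite -mulr_sumr -Esum//.
have ii : intble (fun w => (b + `|u - partial_sum n w|)^-1).
  have := intble_inv P (measurable_partial_sumT (leqnn n)) u 1 b_gt0.
  by under eq_fun do rewrite expr1.
have : E (fun w => \sum_(k < n) V k w) <= E (fun w => 12 * (b + `|u - partial_sum n w|)^-1).
  apply: ae_le_E; [exact: intble_sum|exact: intbleZ|].
  apply: filterS scale_rec => w Sw.
  apply: (@cauchy_weight_sum_le _ n (fun k => scale k w) (fun k => cvar k w)) => // k kn'.
  - exact: scale_geb.
  - by rewrite cvar_ge0 cvar_le_scale.
  - exact: (Sw k.+1).
rewrite EZ//; move: (E _) (E _) => p q h.
lra.
Qed.
End lindeberg.

(** * The bootstrap on the uniform distance *)

Definition cdf_sum (x : R) : R :=
  fine (P [set w | (\sum_(1 <= i < n.+1) xi i w <= x)%R]).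

(** In [H = 385 * C * 72], the factor [72 = 6 * 12] comes from [weight_at_end]
and from the telescoping sum. *)
Lemma distance_halving (C C1 D : R) :
  0 <= C -> expansion_constant C -> 0 <= C1 ->
  (forall u r : R, 1 <= r -> `|Phi (u / r) - Phi u| <= C1 * (r - 1)) ->
  forall H K : R, H = 385 * C * 72 -> K = 4 + 64 * H ->
  e <= 2^-1 -> 0 <= delta <= 2^-1 ->
  (forall x, `|cdf_sum x - Phi x| <= D) ->
  forall x, `|cdf_sum x - Phi x| <= D / 2 +
   (80 * (K + 1) + 24 * H + 2 + C1 * (K ^+ 2 + 1)) * (e * `|ln e| + delta).
Proof.
move=> C0 HC C10 HC1 H K HE KE e2 d12 FD x.
have e12 : 0 < e <= 2^-1 by rewrite e_gt0.
have H0 : 0 <= H by rewrite HE; exact: (mulr_ge0 (mulr_ge0 (ler0n _ _) C0) (ler0n _ _)).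
pose b := K * e; pose s := b + 2 * delta.
have K4 : 4 <= K by rewrite KE lerDl mulr_ge0.
have b0 : 0 < b by rewrite mulr_gt0//; apply: lt_le_trans K4.
have eb : 4 * e <= b by rewrite ler_pM2r.
have [d0 d2] := andP d12.
have s0 : 0 < s by rewrite ltr_pwDl// mulr_ge0.
have D0 : 0 <= D := le_trans (normr_ge0 _) (FD 0).
pose X := partial_sum n; pose S := scale b n.
have mX : measurable_fun [set: T] X := measurable_partial_sumT (leqnn n).
have mS : measurable_fun [set: T] S := measurable_scaleT b (leqnn n).
have S0 w : 0 < S w by exact: scale_gt0.
have Ss : {ae P, forall w, S w <= s}.
  apply: filterS (sum_cvar qc) => w; rewrite ler_norml => /andP[h _].
  rewrite -[s]ger0_norm ?(ltW s0)// -sqrtr_sqr; apply: ler_wsqrtr.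
  rewrite /s sqrrD -[leRHS]addrA lerD2l ge_max.
  have bd : 0 <= b * (2 * delta) by apply: mulr_ge0; [exact: ltW|exact: mulr_ge0].
  have dd := sqr_ge0 delta.
  apply/andP; split; first by rewrite addr_ge0 ?sqr_ge0// mulrn_wge0.
  rewrite exprMn -mulr_natr; move: h bd dd.
  by move: (b * _) (\sum_(_ <= _ < _) _) => p q; lra.
pose r := Num.sqrt (b ^+ 2 + (1 + delta ^+ 2)).
have r2 : r ^+ 2 = b ^+ 2 + (1 + delta ^+ 2) by rewrite sqr_sqrtr// !addr_ge0 ?sqr_ge0.
have r1 : 1 <= r.
  by rewrite -[leLHS]sqrtr1 ler_wsqrtr// addrCA lerDl addr_ge0 ?sqr_ge0.
have rr : r - 1 <= b ^+ 2 + delta ^+ 2.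
  have : r <= r ^+ 2 by rewrite expr2 ler_peMr//; apply: le_trans r1.
  by rewrite r2; lra.
have [L2 [M [eM ML]]] := log_scale e12.
have total u := lindeberg_total eb u C0 erefl HC.
pose tM : R := (2 ^+ M)^-1.
have p2 : 0 < 2 ^+ M :> R by rewrite exprn_gt0.
have tM0 : 0 < tM by rewrite invr_gt0.
have tMe : tM <= e by rewrite -[e]invrK lef_pV2 ?posrE ?invr_gt0.
pose q := 8 * D / b + 6 * M%:R + 2 / b * tM.
have close u : `|Rintegral P setT (fun w => Phi ((u - X w) / S w)) - Phi x| <=
    H * e * q + C1 * (r - 1) + `|u - x|.
  have t1 := total u; have t2 := HC1 u r r1; have t3 := Phi_lipschitz u x.
  have t4 : Rintegral P setT (fun w => (b + `|u - X w|)^-1) <= q.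
    apply: (le_trans (E_inv_le mX FD u M b0)).
    by rewrite /q /tM lerD2l invfM mulrA.
  have t5 : `|Rintegral P setT (fun w => Phi ((u - X w) / S w)) - Phi (u / r)| <= H * e * q.
    apply: (le_trans t1); rewrite -/X.
    have -> : H * e * q = 385 * C * e * (72 * q) by rewrite HE; ring.
    apply: ler_wpM2l; last exact: (ler_wpM2l (ler0n _ _)).
    exact: (mulr_ge0 (mulr_ge0 (ler0n _ _) C0) (ltW e_gt0)).
  apply: (le_trans (ler_distD (Phi (u / r)) _ _)).
  rewrite -addrA; apply: lerD => //.
  by apply: (le_trans (ler_distD (Phi u) _ _)); exact: lerD.
(* 32 makes the coefficient 128 / 32 ^ 2 of D in the tail error equal to 1 / 8 *)
have a0 : 0 < 32 :> R by [].
have up := smoothing_upper mX FD mS S0 Ss s0 a0 x.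
have lo := smoothing_lower mX FD mS S0 Ss s0 a0 x.
have tailE := smoothing_error_le D s0.
have cu := close (x + 32 * s); have cl := close (x - 32 * s).
have s32 : 0 <= 32 * s by rewrite pmulr_rge0// ltW.
have du : `|x + 32 * s - x| = 32 * s by rewrite addrAC subrr add0r ger0_norm.
have dl : `|x - 32 * s - x| = 32 * s by rewrite addrAC subrr add0r normrN ger0_norm.
rewrite du in cu; rewrite dl in cl.
have fin := error_budget D0 H0 C10 e12 L2 d12 KE erefl erefl ML tM0 tMe rr (lexx q).
apply: le_trans fin.
by apply: (sandwich_le cu cl up lo tailE).
Qed.

End martingale.

Theorem theorem3p1 (R : realType) :
  exists c : R, 0 < c /\
    forall (d : measure_display) (T : measurableType d) (P : probability T R)
      (n : nat) (F : nat -> set (set T)) (xi : nat -> T -> R)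
      (epsilon delta : R),
      (1 <= n)%N ->
      0 < epsilon <= 2^-1 ->
      0 <= delta <= 2^-1 ->
      martingale_difference P n F xi ->
      bernstein_condition P n F xi epsilon ->
      quad_char_condition P n F xi delta ->
      (ereal_sup (range (fun x : R =>
         `| P [set w | (\sum_(1 <= i < n.+1) xi i w <= x)%R] - std_normal_cdf x |))
       <= (c * (epsilon * `|ln epsilon| + delta))%R%:E)%E.
Proof.
have [C C0 HC] := expansion_constant_exists R.
have [C1 C10 HC1] := Phi_scale R.
pose H := 385 * C * 72; pose K := 4 + 64 * H.
pose c0 := 80 * (K + 1) + 24 * H + 2 + C1 * (K ^+ 2 + 1).
have H0 : 0 <= H := mulr_ge0 (mulr_ge0 (ler0n _ _) C0) (ler0n _ _).
have c00 : 0 < c0.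
  have K0 : 0 <= K by rewrite /K addr_ge0 // (mulr_ge0 (ler0n _ _)).
  have t : 0 <= C1 * (K ^+ 2 + 1) by rewrite mulr_ge0// addr_ge0 ?sqr_ge0.
  by rewrite /c0; move: (K) (H) (C1 * _) K0 H0 t => k h t k0 h0 t0; lra.
exists (2 * c0); split; first by rewrite pmulr_rgt0.
move=> d T P n F xi e delta _ /andP[e0 e2] d12 md bc qc.
pose f x := `|cdf_sum P n xi x - Phi x|.
have mA x : measurable [set w | \sum_(1 <= i < n.+1) xi i w <= x].
  apply: measurable_le_fun => //.
  exact: (measurable_partial_sumT md (leqnn n)).
have PE x : P [set w | \sum_(1 <= i < n.+1) xi i w <= x] = (cdf_sum P n xi x)%:E.
  by rewrite /cdf_sum fineK// fin_num_measure.
have cdf01 x : 0 <= cdf_sum P n xi x <= 1.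
  by rewrite -!lee_fin -PE measure_ge0 probability_le1.
have f1 x : f x <= 1.
  have := cdf01 x; have := Phi_ge0 x; have := Phi_le1 x.
  by rewrite /f ler_norml; lra.
have fsup : has_sup (range f).
  by split; [exists (f 0), 0|exists 1 => _ [x _ <-]].
(* the distance is finite, so it can serve as its own a priori bound *)
pose D := sup (range f).
have fD x : f x <= D by apply: sup_upper_bound => //; exists x.
have : D <= D / 2 + c0 * (e * `|ln e| + delta).
  apply: ge_sup; first by exists (f 0), 0.
  move=> _ [x _ <-].
  exact: (distance_halving md bc e0 qc C0 HC C10 HC1 erefl erefl e2 d12 fD).
move=> D2.
have {}D2 : D <= 2 * c0 * (e * `|ln e| + delta) by rewrite -mulrA; lra.
apply: ge_ereal_sup => _ [x _ <-].
have -> : std_normal_cdf x = (Phi x)%:E.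
  by rewrite Phi_prob.
by rewrite PE -EFinB abse_EFin lee_fin; exact: le_trans (fD x) D2.
Qed.
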